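(* Let $X,U_1,U_2,Z$ be Banach spaces, let $A$ be the generator of a $C_0$-semigroup $(T(t))_{t\ge0}$ on $X$, let $p_1,p_2\in[1,\infty)$, let $B_1\in\mathcal L(Z,X_{-1})$ be $L^{p_1}$-admissible and $B_2\in\mathcal L(U_2,X_{-1})$ be $L^{p_2}$-admissible for $(T(t))_{t\ge0}$, and let $F\colon U_1\times X\to Z$ be bilinear and bounded. Then, for any $t_e>0$, the mild solution $x$ of \[ \dot x(t)=Ax(t)+B_1F(u_1(t),x(t))+B_2u_2(t),\qquad x(0)=x_0, \] depends continuously in $C([0,t_e];X)$ on $x_0\in X$, $u_1\in L^{p_1}([0,t_e];U_1)$ and $u_2\in L^{p_2}([0,t_e];U_2)$; that is, the map \[ X\times L^{p_1}([0,t_e];U_1)\times L^{p_2}([0,t_e];U_2)\to C([0,t_e];X),\qquad (x_0,u_1,u_2)\mapsto x|_{[0,t_e]}, \] is continuous.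
   Context: Extrapolation space: $X_{-1}$ is the completion of $X$ with respect to the norm $\|(\lambda-A)^{-1}\cdot\|_X$ for some $\lambda\in\rho(A)$ (different $\lambda$ give equivalent norms). $(T(t))_{t\ge0}$ extends uniquely to a $C_0$-semigroup $(T_{-1}(t))_{t\ge0}$ on $X_{-1}$. Boundedness of $F$: there is $C>0$ with $\|F(u,x)\|_Z\le C\|u\|_{U_1}\|x\|_X$ for all $u\in U_1$, $x\in X$. Admissibility: for $p\in[1,\infty)$ and a Banach space $V$, an operator $B\in\mathcal L(V,X_{-1})$ is $L^p$-admissible for $(T(t))_{t\ge0}$ if there exists $t>0$ such that $\int_0^t T_{-1}(t-s)Bv(s)\,\mathrm ds\in X$ for all $v\in L^p([0,\infty);V)$. The mild solution on $[0,t_e]$ is the function $x\in C([0,t_e];X)$ such that for all $t\in[0,t_e]$ \[ x(t)=T(t)x_0+\int_0^tT_{-1}(t-s)\bigl(B_1F(u_1(s),x(s))+B_2u_2(s)\bigr)\,\mathrm ds . \] It is known that, under the stated assumptions, it exists and is unique for all such data (and it is the restriction to $[0,t_e]$ of the global mild solution for any locally $L^{p_i}$ extensions of $u_1,u_2$ to $[0,\infty)$). $C([0,t_e];X)$ carries the supremum norm. *)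

(* Defs.v *)
From HB Require Import structures.
From mathcomp Require Import all_boot all_order all_algebra.
From mathcomp Require Import all_classical all_reals all_analysis.
From mathcomp Require Import complex.

Set Implicit Arguments.
Unset Strict Implicit.
Unset Printing Implicit Defensive.

Import Order.TTheory GRing.Theory Num.Theory.
Import numFieldNormedType.Exports.

Local Open Scope classical_set_scope.
Local Open Scope ring_scope.

Variant scalar_kind := RealScalars | ComplexScalars.

Definition scalar_field (R : realType) (k : scalar_kind) : numFieldType :=
  match k with
  | RealScalars => R
  | ComplexScalars => (R[i])%C
  end.

Definition of_real (R : realType) (k : scalar_kind) : R -> scalar_field R k :=
  match k with
  | RealScalars => fun r => r
  | ComplexScalars => fun r => (r%:C)%C
  end.

(* Norms in a [normedModType K] are K-valued; for K = R[i] they are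
   nonnegative reals embedded in K, so that taking the real part loses
   nothing. *)
Definition re_part (R : realType) (k : scalar_kind) : scalar_field R k -> R :=
  match k with
  | RealScalars => fun r => r
  | ComplexScalars => fun z => complex.Re z
  end.

Definition rnorm (R : realType) (k : scalar_kind)
    (V : normedModType (scalar_field R k)) (v : V) : R :=
  re_part `|v|.

Section Bochner.
Context (R : realType) (k : scalar_kind) (V : normedModType (scalar_field R k)).
Implicit Types (D : set R) (f s : R -> V).

Local Notation mu := (@lebesgue_measure R).

Definition vsimple s : Prop :=
  finite_set (range s) /\ forall v, measurable (s @^-1` [set v]).

(* Convergence is required everywhere on D rather than almost everywhere:
   every class of almost everywhere equal functions contains such a
   representative, and s |-> rnorm (f s) is then Borel measurable on D. *)
Definition strongly_measurable D f : Prop :=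
  exists s_ : nat -> R -> V, (forall n, vsimple (s_ n)) /\
    forall t, D t -> s_ n t @[n --> \oo] --> f t.

(* For an integrable s, only the value v = 0 can have an infinite weight,
   in which case [fine] replaces it by 0. *)
Definition simple_integral D s : V :=
  \sum_(v \in range s)
     of_real k (fine (mu (D `&` s @^-1` [set v]))) *: v.

(* f is Bochner integrable on D with integral I. *)
Definition is_bochner_integral D f (I : V) : Prop :=
  strongly_measurable D f /\
  exists s_ : nat -> R -> V,
    [/\ forall n, vsimple (s_ n),
        forall n, (\int[mu]_(t in D) (rnorm (s_ n t))%:E < +oo)%E,
        (\int[mu]_(t in D) (rnorm (f t - s_ n t))%:E)%E @[n --> \oo] --> 0%E &
        simple_integral D (s_ n) @[n --> \oo] --> I].

Definition Lp_norm D (p : R) f : \bar R :=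
  ('N[mu]_(p%:E) [EFin \o ((fun t => rnorm (f t)) \_ D)])%E.

(* f represents an element of L^p(D; V). *)
Definition in_Lp D (p : R) f : Prop :=
  strongly_measurable D f /\ (Lp_norm D p f < +oo)%E.

Definition sup_norm D f : \bar R :=
  ereal_sup [set (rnorm (f t))%:E | t in D].

End Bochner.

Section Semigroups.
Context (R : realType) (k : scalar_kind).
Local Notation K := (scalar_field R k).

(* The values T t for t < 0 are irrelevant. *)
Definition C0_semigroup (X : normedModType K) (T : R -> {linear X -> X}) :
    Prop :=
  [/\ forall t, 0 <= t -> continuous (T t),
      forall x, T 0 x = x,
      forall s t, 0 <= s -> 0 <= t -> forall x, T (s + t) x = T s (T t x) &
      forall x, T h x @[h --> (0 : R)^'+] --> x].

(* An unbounded operator is a pair of a domain domA and a function A whose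
   values outside domA are irrelevant. *)
Definition is_generator (X : normedModType K) (T : R -> {linear X -> X})
    (domA : set X) (A : X -> X) : Prop :=
  forall x y, (domA x /\ A x = y) <->
    (of_real k h)^-1 *: (T h x - x) @[h --> (0 : R)^'+] --> y.

(* lambda belongs to the resolvent set of A and Q = (lambda - A)^-1. *)
Definition is_resolvent (X : normedModType K) (domA : set X) (A : X -> X)
    (lambda : K) (Q : {linear X -> X}) : Prop :=
  [/\ continuous Q,
      forall y, domA (Q y) /\ lambda *: Q y - A (Q y) = y &
      forall x, domA x -> Q (lambda *: x - A x) = x].

(* j : X -> Xm1 is the canonical embedding into a completion. *)
Definition is_extrapolation_space (X : normedModType K) (domA : set X)
    (A : X -> X) (Xm1 : completeNormedModType K) (j : {linear X -> Xm1}) :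
    Prop :=
  dense (range j) /\
  exists (lambda : K) (Q : {linear X -> X}),
    is_resolvent domA A lambda Q /\ forall x, `|j x| = `|Q x|.

Definition is_extrapolated_semigroup (X Xm1 : normedModType K)
    (j : {linear X -> Xm1}) (T : R -> {linear X -> X})
    (Tm1 : R -> {linear Xm1 -> Xm1}) : Prop :=
  C0_semigroup Tm1 /\
  forall t, 0 <= t -> forall x, Tm1 t (j x) = j (T t x).

Definition Lp_admissible (X Xm1 V : normedModType K) (j : {linear X -> Xm1})
    (Tm1 : R -> {linear Xm1 -> Xm1}) (p : R) (B : {linear V -> Xm1}) : Prop :=
  exists2 t : R, 0 < t &
    forall v : R -> V, in_Lp `[0, +oo[ p v ->
      exists x : X,
        is_bochner_integral `[0, t] (fun s => Tm1 (t - s) (B (v s))) (j x).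

Definition bounded_bilinear (U X Z : normedModType K)
    (F : {bilinear U -> X -> Z}) : Prop :=
  exists2 C : R, 0 < C &
    forall u x, rnorm (F u x) <= C * rnorm u * rnorm x.

(* x is only relevant on [0, te]. *)
Definition is_mild_solution (X Xm1 U1 U2 Z : normedModType K)
    (j : {linear X -> Xm1}) (T : R -> {linear X -> X})
    (Tm1 : R -> {linear Xm1 -> Xm1})
    (B1 : {linear Z -> Xm1}) (B2 : {linear U2 -> Xm1})
    (F : {bilinear U1 -> X -> Z}) (te : R)
    (x0 : X) (u1 : R -> U1) (u2 : R -> U2) (x : R -> X) : Prop :=
  {within `[0, te], continuous x} /\
  forall t, 0 <= t <= te ->
    exists2 I : Xm1,
      is_bochner_integral `[0, t]
        (fun s => Tm1 (t - s) (B1 (F (u1 s) (x s)) + B2 (u2 s))) I &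
      j (x t) = j (T t x0) + I.

End Semigroups.

(* Main.v *)
(* Fix an admissible B and let v |-> x_v in X be the map
   x_v = int_0^tau T_{-1}(tau - s) B v(s) ds on L^p(0, tau).  It is bounded by the
   following closed-graph argument.  With Q = (lambda - A)^-1, the operators
   W_h = lambda Q - h^-1 (T(h) - 1) Q are bounded from the norm of X_{-1} to that
   of X, and W_h x -> x as h -> 0+.  Hence each v |-> W_h x_v is bounded on L^p, and
   since the family is pointwise bounded it is uniformly bounded, so that v |-> x_v
   is bounded too.  The uniform boundedness principle is applied to simple
   functions, by a gliding hump whose limit is a series of simple functions; this
   avoids setting up L^p as a Banach space.  Translating windows of length tau
   gives |int_0^t T_{-1}(t - s) B v(s) ds| <= K |v|_{L^p(0,t)} for all t <= te.

   If x, x' are mild solutions and y = x' - x, then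
     y(t) = T(t) y(0) + int_0^t T_{-1}(t - s) (B1 w(s) + B2 (u2' - u2)(s)) ds
   with w = F(u1' - u1, x') + F(u1, y).  Since the integral of |u1|^p1 is absolutely
   continuous, the contribution of F(u1, y) over a short time window is absorbed
   into the supremum of |y|, and finitely many windows cover [0, te]. *)

Require Import Defs.
From HB Require Import structures.
From mathcomp Require Import all_boot all_order all_algebra.
From mathcomp Require Import all_classical all_reals all_analysis.
From mathcomp Require Import complex.
From mathcomp Require Import ring lra finmap measurable_realfun.

Set Implicit Arguments.
Unset Strict Implicit.
Unset Printing Implicit Defensive.

Import Order.TTheory GRing.Theory Num.Theory.
Import numFieldNormedType.Exports.

Local Open Scope classical_set_scope.
Local Open Scope ring_scope.

(** * Real-valued norms *)

(** The uniform boundedness principle is needed for two families: the operators [T t] for small t,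
    on the Banach space X, and the regularised maps on simple functions, which do not form a
    complete space. The hump is therefore built once, on a real subspace with a seminorm, and
    completeness is replaced by a promise of the caller: no sequence with increments of size at most
    2^-n keeps the n-th chosen functional above n on all later terms. For simple functions the
    promise holds because such a sequence converges in L^1 to an element of L^p, and each W_h x_v is
    already continuous in v for the L^1 distance.

    In the comparison of mild solutions, x' has no bound uniform in the data. So F(u1' - u1, x') is
    estimated through |x| + |y|, and its share of |y| is absorbed too, this time by the smallness of
    u1' - u1. Absorption requires sup |y| to be finite, which continuity on [0, te] gives, but the
    size of this supremum does not enter the result. Each of the two absorbed terms is kept below a
    quarter of the supremum. The outcome is a Lipschitz estimate near the given data, with a
    constant depending on x and u1. *)

Section ScalarField.
Variables (R : realType) (k : scalar_kind).
Local Notation K := (scalar_field R k).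
Local Notation ofR := (@of_real R k).

Lemma of_realK : cancel ofR (@re_part R k).
Proof. by case: k. Qed.

Lemma of_realM : {morph ofR : x y / x * y}.
Proof. by case: k => // x y; rewrite /= rmorphM. Qed.

Lemma of_realD : {morph ofR : x y / x + y}.
Proof. by case: k => // x y; rewrite /= rmorphD. Qed.

Lemma of_realN : {morph ofR : x / - x}.
Proof. by case: k => // x; rewrite /= rmorphN. Qed.

Lemma of_real0 : ofR 0 = 0.
Proof. by case: k. Qed.

Lemma of_real1 : ofR 1 = 1.
Proof. by case: k. Qed.

Lemma of_realV : {morph ofR : x / x^-1}.
Proof. by case: k => // x; rewrite /= fmorphV. Qed.

Lemma ler_of_real x y : (ofR x <= ofR y) = (x <= y).
Proof. by case: k => //=; rewrite lecR. Qed.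

Lemma ltr_of_real x y : (ofR x < ofR y) = (x < y).
Proof. by case: k => //=; rewrite ltcR. Qed.

Lemma normr_of_real x : `|ofR x| = ofR `|x|.
Proof. by case: k => //=; rewrite normc_def /= expr0n addr0 sqrtr_sqr. Qed.

Lemma re_part_ge0 (z : K) : 0 <= z -> ofR (re_part z) = z.
Proof. by case: k z => //= z; rewrite lecE /= => /andP[/eqP z0 _]; case: z z0 => a b /= ->. Qed.

Lemma re_part_gt0 (z : K) : 0 < z -> 0 < re_part z.
Proof. by move=> z0; rewrite -ltr_of_real of_real0 re_part_ge0 // ltW. Qed.

End ScalarField.

Section RealNorm.
Variables (R : realType) (k : scalar_kind).
Local Notation K := (scalar_field R k).
Local Notation ofR := (@of_real R k).
Variable V : normedModType K.
Implicit Types u v : V.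

Lemma of_real_rnorm v : ofR (rnorm v) = `|v|.
Proof. exact: re_part_ge0. Qed.

Lemma rnorm_ge0 v : 0 <= rnorm v.
Proof. by rewrite -(ler_of_real k) of_real_rnorm of_real0. Qed.

Lemma rnorm0 : rnorm (0 : V) = 0.
Proof. by rewrite /rnorm normr0 -(of_real0 R k) of_realK. Qed.

Lemma rnorm0_eq0 v : rnorm v = 0 -> v = 0.
Proof.
by move=> v0; apply/normr0_eq0; rewrite -of_real_rnorm v0 of_real0.
Qed.

Lemma rnormN v : rnorm (- v) = rnorm v.
Proof. by rewrite /rnorm normrN. Qed.

Lemma rnormBC u v : rnorm (u - v) = rnorm (v - u).
Proof. by rewrite -rnormN opprB. Qed.

Lemma rnormD u v : rnorm (u + v) <= rnorm u + rnorm v.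
Proof. by rewrite -(ler_of_real k) of_realD !of_real_rnorm ler_normD. Qed.

Lemma rnormB u v : rnorm (u - v) <= rnorm u + rnorm v.
Proof. by rewrite -(rnormN v) rnormD. Qed.

Lemma rnorm_dist u v : rnorm u <= rnorm v + rnorm (u - v).
Proof. by rewrite -{1}(subrK v u) addrC rnormD. Qed.

Lemma rnormZ (a : K) v : rnorm (a *: v) = re_part `|a| * rnorm v.
Proof.
apply: (can_inj (@of_realK R k)).
by rewrite of_realM !of_real_rnorm normrZ re_part_ge0.
Qed.

Lemma rnormZr (r : R) v : rnorm (ofR r *: v) = `|r| * rnorm v.
Proof. by rewrite rnormZ normr_of_real of_realK. Qed.

Lemma rnorm_sum (I : Type) (r : seq I) (P : pred I) (f : I -> V) :
  rnorm (\sum_(i <- r | P i) f i) <= \sum_(i <- r | P i) rnorm (f i).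
Proof.
elim/big_ind2: _ => [|x a y b xa yb|//]; first by rewrite rnorm0.
exact: le_trans (rnormD _ _) (lerD _ _).
Qed.

(** The bridge from the scalar-valued norm to the real-valued one: limits over real and complex
    scalars are from here on handled by the same real estimates. *)
Lemma cvg_rnormP (T : Type) (G : set_system T) {FG : Filter G} (f : T -> V) v :
  f x @[x --> G] --> v <-> rnorm (f x - v) @[x --> G] --> (0 : R).
Proof.
split=> [/cvgrPdist_lt fv|/cvgrPdist_lt fv]; apply/cvgrPdist_lt => e e0.
  have : 0 < ofR e by rewrite -(of_real0 R k) ltr_of_real.
  move=> /fv; apply: filterS => x.
  by rewrite sub0r normrN ger0_norm ?rnorm_ge0 // -of_real_rnorm ltr_of_real rnormBC.
have /fv := re_part_gt0 e0; apply: filterS => x.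
rewrite sub0r normrN ger0_norm ?rnorm_ge0 // -(ltr_of_real k).
by rewrite of_real_rnorm re_part_ge0 ?ltW // distrC.
Qed.

Lemma cvg_rnorm (T : Type) (G : set_system T) {FG : Filter G} (f : T -> V) v :
  f x @[x --> G] --> v -> rnorm (f x) @[x --> G] --> rnorm v.
Proof.
move=> /cvg_rnormP/cvgrPdist_lt fv; apply/cvgrPdist_lt => e /fv.
apply: filterS => x; rewrite sub0r normrN ger0_norm ?rnorm_ge0 //.
apply: le_lt_trans; rewrite ler_norml; apply/andP; split.
  by rewrite lerBrDr addrC -lerBrDr opprK rnorm_dist.
by rewrite lerBlDl rnormBC rnorm_dist.
Qed.

Lemma squeeze_rnorm (T : Type) (G : set_system T) {FG : Filter G}
    (f : T -> V) v (h : T -> R) :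
  (\forall x \near G, rnorm (f x - v) <= h x) -> h x @[x --> G] --> (0 : R) ->
  f x @[x --> G] --> v.
Proof.
move=> fh h0; apply/cvg_rnormP; apply: (@squeeze_cvgr _ _ _ _ (fun=> 0) h) => //.
  by apply: filterS fh => x ->; rewrite rnorm_ge0.
exact: cvg_cst.
Qed.

End RealNorm.

Lemma rnorm_complete (R : realType) (k : scalar_kind)
    (V : completeNormedModType (scalar_field R k)) (u : V^nat) (e : R^nat) :
  (forall m n, (n <= m)%N -> rnorm (u m - u n) <= e n) ->
  e n @[n --> \oo] --> (0 : R) -> cvgn u.
Proof.
move=> ue e0; apply/cauchy_cvgP/cauchy_ballP => eps eps0.
have r0 : 0 < re_part eps / 2 by rewrite divr_gt0 // re_part_gt0.
move/cvgrPdist_lt : e0 => /(_ _ r0)[N _ /(_ N (leqnn N))] /=.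
rewrite sub0r normrN => eN.
have H m : (N <= m)%N -> rnorm (u m - u N) < re_part eps / 2.
  by move=> /ue /le_lt_trans; apply; apply: le_lt_trans eN; exact: ler_norm.
exists (u @` [set m | N <= m]%N, u @` [set m | N <= m]%N) => /=.
  by split; exists N => // m /= Nm; exists m.
move=> [x y] /= [[m Nm <-] [n Nn <-]].
rewrite -ball_normE /= -of_real_rnorm -(re_part_ge0 (ltW eps0)) ltr_of_real.
have -> : u m - u n = (u m - u N) - (u n - u N) by rewrite opprB addrA subrK.
by rewrite [X in _ < X]splitr (le_lt_trans (rnormB _ _)) // ltrD // H.
Qed.

Section LinearBound.
Variables (R : realType) (k : scalar_kind).
Variables (V W : normedModType (scalar_field R k)).

Lemma continuous_linear_bound (L : {linear V -> W}) : continuous L ->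
  exists2 C : R, 0 < C & forall v, rnorm (L v) <= C * rnorm v.
Proof.
move=> /linear_bounded_continuous/linear_boundedP [M [Mr HM]].
(* The threshold M lives in the scalar field. The real part of |M| + 1 is a real number above it,
   and the last + 1 makes C positive. *)
pose C := re_part (`|M| + 1) + 1.
have MC : M < of_real k C.
  rewrite of_realD of_real1 re_part_ge0 ?addr_ge0 //.
  rewrite (le_lt_trans (real_ler_norm Mr)) // -addrA ltrDl.
  by rewrite (@addr_gt0 (scalar_field R k)) // ltr01.
exists C; last first.
  by move=> v; rewrite -(ler_of_real k) of_realM !of_real_rnorm HM.
rewrite /C ltr_wpDl // -(ler_of_real k) of_real0 re_part_ge0 ?addr_ge0 //.
Qed.

End LinearBound.

(** * Gliding hump and local boundedness of semigroups *)

Section GlidingHump.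
Variables (R : realType) (k : scalar_kind) (E : lmodType (scalar_field R k)).
Local Notation ofR := (@of_real R k).
Variable S : set E.

(** Real scalars suffice, since the hump only rescales by positive reals; homogeneity can then be
    stated with real absolute values for both scalar fields. *)
Definition real_subspace :=
  (forall x y, S x -> S y -> S (x + y)) /\ forall r x, S x -> S (ofR r *: x).

Definition seminorm_on (N : E -> R) :=
  (forall x y, S x -> S y -> N (x + y) <= N x + N y) /\
  forall r x, S x -> N (ofR r *: x) = `|r| * N x.

Hypothesis SS : real_subspace.

Lemma real_subspaceB x y : S x -> S y -> S (x - y).
Proof.
case: SS => SD SZ Sx Sy; apply: SD => //.
by rewrite -scaleN1r -(of_real1 R k) -of_realN; exact: SZ.
Qed.

Lemma seminormN N x : seminorm_on N -> S x -> N (- x) = N x.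
Proof.
move=> [_ NZ] Sx.
by rewrite -scaleN1r -(of_real1 R k) -of_realN NZ // normrN1 mul1r.
Qed.

Lemma seminorm0 N x : seminorm_on N -> S x -> N 0 = 0.
Proof. by move=> [_ NZ] Sx; rewrite -(scale0r x) -(of_real0 R k) NZ // normr0 mul0r. Qed.

Lemma seminormB N x y : seminorm_on N -> S x -> S y -> N (x - y) <= N x + N y.
Proof.
move=> sN Sx Sy; rewrite -(seminormN sN Sy); apply: (proj1 sN) => //.
by rewrite -sub0r -(subrr y); do !apply: real_subspaceB.
Qed.

Lemma seminormBC N x y : seminorm_on N -> S x -> S y -> N (x - y) = N (y - x).
Proof. by move=> sN Sx Sy; rewrite -opprB seminormN //; exact: real_subspaceB. Qed.

Lemma seminorm_dist N x y : seminorm_on N -> S x -> S y -> N x <= N y + N (x - y).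
Proof.
move=> sN Sx Sy; rewrite -{1}(subrK y x) addrC; apply: (proj1 sN) => //.
exact: real_subspaceB.
Qed.

Lemma seminorm_ge0 N x : seminorm_on N -> S x -> 0 <= N x.
Proof.
move=> sN Sx; have := seminormB sN Sx Sx.
by rewrite subrr (seminorm0 sN Sx) -mulr2n pmulrn_lge0.
Qed.

Variables (I : Type) (N : E -> R) (g : I -> E -> R).
Hypotheses (sN : seminorm_on N) (sg : forall i, seminorm_on (g i)).
Hypothesis gN : forall i, exists c, forall x, S x -> g i x <= c * N x.

(* Since g i (x + d) + g i (x - d) >= 2 g i d, one of x + d and x - d is
   moved far out by some g i. *)
Lemma gliding_hump_step x r (a : R) :
  ~ (exists C, forall i x, S x -> g i x <= C * N x) ->
  0 < r -> 0 < a -> S x ->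
  exists w i r', [/\ S w, 0 < r' <= r / 2, N (w - x) <= r / 2 &
    forall z, S z -> N (z - w) <= r' -> a <= g i z].
Proof.
move=> unb r0 a0 Sx; case: SS => SD SZ.
(* Chosen so that z, rescaled to a vector d with N d = r / 2, satisfies g i d > a + 1. *)
pose C := (a + 1) * 2 / r.
have [i [z [Sz giz]]] : exists i z, S z /\ C * N z < g i z.
  apply: contrapT => H; apply: unb; exists C => i z Sz; rewrite leNgt; apply/negP => giz.
  by apply: H; exists i, z.
have [c cH] := gN i.
have Nz : 0 < N z.
  rewrite lt_neqAle seminorm_ge0 // andbT eq_sym; apply/eqP => Nz0.
  by have := cH _ Sz; rewrite Nz0 mulr0 leNgt (le_lt_trans _ giz) // Nz0 mulr0.
pose d := ofR (r / 2 / N z) *: z.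
have Sd : S d by exact: SZ.
have t0 : 0 < r / 2 / N z by rewrite !divr_gt0.
have Nd : N d = r / 2 by rewrite (proj2 sN) // gtr0_norm // divfK // gt_eqF.
have gd : a + 1 < g i d.
  rewrite (proj2 (sg i)) // gtr0_norm // -ltr_pdivrMl //.
  apply: le_lt_trans giz; rewrite le_eqVlt; apply/orP; left; apply/eqP.
  rewrite /C invfM invfM !invrK; field; rewrite ?gt_eqF //.
have [w [Sw Nw gw]] : exists w, [/\ S w, N (w - x) <= r / 2 & a + 1 <= g i w].
  have Sm : S (x - d) by exact: real_subspaceB.
  have Sp : S (x + d) by exact: SD.
  have [h|h] := leP (a + 1) (g i (x + d)).
    by exists (x + d); split=> //; rewrite [x + d]addrC addrK Nd.
  exists (x - d); split => //; first by rewrite addrAC subrr sub0r seminormN // Nd.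
  have := seminormB (sg i) Sp Sm.
  rewrite opprB addrCA addrA addrAC addrA subrK -mulr2n -scaler_nat.
  have -> : (2%:R : scalar_field R k) = ofR 2.
    by rewrite mulr2n [in RHS](mulr2n 1) of_realD of_real1.
  rewrite (proj2 (sg i)) // ger0_norm //; lra.
(* Within distance 1 / (|c| + 1) of w the seminorm g i drops by at most 1, from a + 1 to a. *)
pose r' := Num.min (r / 2) (1 / (`|c| + 1)).
have c1 : 0 < `|c| + 1 by rewrite ltr_wpDl.
have r'0 : 0 < r' by rewrite lt_min !divr_gt0.
exists w, i, r'; split => //; first by rewrite r'0 ge_min lexx.
move=> y Sy Ny.
have := seminorm_dist (sg i) Sw Sy; have := cH _ (real_subspaceB Sw Sy).
rewrite (seminormBC sN) //; set n := N _ in Ny *.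
have : c * n <= 1.
  have n0 : 0 <= n by apply: seminorm_ge0 => //; exact: real_subspaceB.
  apply: (@le_trans _ _ ((`|c| + 1) * (1 / (`|c| + 1)))); last first.
    by rewrite mulrC divfK // gt_eqF.
  apply: (le_trans (ler_wpM2r n0 (ler_norm c))).
  apply: ler_pM => //; first by rewrite lerDl.
  by apply: (le_trans Ny); rewrite ge_min lexx orbT.
move=> h1 h2 h3; lra.
Qed.

(** If no uniform bound held, repeated hump steps would give nested balls with radii at least halved
    each time, the n-th functional being at least n on a whole ball. The centres form a sequence of
    the kind that the second hypothesis excludes; finding its limit is left to the caller. *)
Lemma gliding_hump : S 0 ->
  (forall (x : nat -> E) (i : nat -> I), (forall n, S (x n)) ->
    (forall n, N (x n.+1 - x n) <= 2^-1 ^+ n) ->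
    ~ (forall m n, (n <= m)%N -> n%:R <= g (i n) (x m))) ->
  exists2 C, 0 < C & forall i x, S x -> g i x <= C * N x.
Proof.
move=> S0 nohump.
suff [C CH] : exists C, forall i x, S x -> g i x <= C * N x.
  exists (`|C| + 1); first by rewrite ltr_wpDl.
  move=> i x Sx; apply: (le_trans (CH i x Sx)); apply: ler_wpM2r.
    exact: seminorm_ge0.
  by rewrite (le_trans (ler_norm _)) // lerDl.
apply: contrapT => unb.
(* A state is the centre and the positive radius of a ball. *)
pose st := {xr : E * R | S xr.1 /\ 0 < xr.2}.
have step (n : nat) (s : st) : exists p : st * I,
    [/\ (sval p.1).2 <= (sval s).2 / 2,
        N ((sval p.1).1 - (sval s).1) <= (sval s).2 / 2 &
        forall z, S z -> N (z - (sval p.1).1) <= (sval p.1).2 -> n%:R <= g p.2 z].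
  case: s => -[x r] /= [Sx r0].
  (* A hump step wants a positive level, hence n + 1 where n is enough. *)
  have [w [i [r' [Sw /andP[r'0 r'r] Nw H]]]] :=
    gliding_hump_step unb r0 (ltr0Sn R n) Sx.
  exists (exist _ (w, r') (conj Sw r'0) : st, i); split => //= z Sz /(H _ Sz).
  by apply: le_trans; rewrite ler_nat.
pose s0 : st := exist _ (0, 1) (conj S0 ltr01).
pose nxt n s := projT1 (cid (step n s)).
pose s := fix s n := if n is n'.+1 then (nxt n' (s n')).1 else s0.
pose xx n := (sval (s n)).1; pose rr n := (sval (s n)).2.
have Sxx n : S (xx n) by rewrite /xx; case: (s n) => [[? ?] []].
have P n : [/\ rr n.+1 <= rr n / 2, N (xx n.+1 - xx n) <= rr n / 2 &
    forall z, S z -> N (z - xx n.+1) <= rr n.+1 -> n%:R <= g (nxt n (s n)).2 z].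
  exact: projT2 (cid (step n (s n))).
have rrE n : rr n <= 2^-1 ^+ n.
  elim: n => [|n IH]; first by rewrite expr0.
  by have [+ _ _] := P n; rewrite exprSr => /le_trans; apply; rewrite ler_wpM2r.
have rr0 n : 0 < rr n by rewrite /rr; case: (s n) => [[? ?] []].
(* Nestedness of the balls: the distance between centres is at most the difference of the radii. *)
have nest m n : (n <= m)%N -> N (xx m - xx n) <= rr n - rr m.
  elim: m => [|m IH]; first by rewrite leqn0 => /eqP ->; rewrite !subrr (seminorm0 sN S0).
  rewrite leq_eqVlt => /orP[/eqP ->|/IH {}IH].
    by rewrite !subrr (seminorm0 sN S0).
  have [r1 r2 _] := P m.
  have -> : xx m.+1 - xx n = (xx m.+1 - xx m) + (xx m - xx n) by rewrite addrA subrK.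
  apply: (le_trans ((proj1 sN) _ _ _ _)); [exact: real_subspaceB|exact: real_subspaceB|].
  have := rr0 m; lra.
(* The functional picked at stage n is large on the ball around the next centre, whence the shift by
   one. *)
apply: (nohump (fun n => xx n.+1) (fun n => (nxt n (s n)).2)) => // [n|m n nm].
  have [_ + _] := P n.+1; move=> /le_trans; apply.
  have := rrE n.+1; rewrite exprSr; set t := _ ^+ n.
  have : 0 <= t by rewrite exprn_ge0.
  lra.
have [_ _ ] := P n; apply => //; apply: (le_trans (nest _ _ _)) => //.
by have := rr0 m.+1; lra.
Qed.

End GlidingHump.

Lemma seminorm_geometric_tail (R : realType) (k : scalar_kind)
    (E : lmodType (scalar_field R k)) (S : set E) (N : E -> R) (x : nat -> E) :
  real_subspace S -> seminorm_on S N -> (forall n, S (x n)) ->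
  (forall n, N (x n.+1 - x n) <= 2^-1 ^+ n) ->
  forall m n, (n <= m)%N -> N (x m - x n) <= 2 * 2^-1 ^+ n.
Proof.
move=> SS sN Sx xN m n nm.
(* The subtracted term makes the geometric bound additive, so that the induction on m closes. *)
suff : N (x m - x n) <= 2 * 2^-1 ^+ n - 2 * 2^-1 ^+ m.
  by move/le_trans; apply; rewrite gerBl mulr_ge0 // exprn_ge0.
elim: m nm => [|m IH].
  by rewrite leqn0 => /eqP ->; rewrite !subrr (seminorm0 sN (Sx 0%N)).
rewrite leq_eqVlt => /orP[/eqP ->|/IH {}IH].
  by rewrite !subrr (seminorm0 sN (Sx 0%N)).
have -> : x m.+1 - x n = (x m.+1 - x m) + (x m - x n) by rewrite addrA subrK.
apply: (le_trans ((proj1 sN) _ _ _ _)); [exact: real_subspaceB|exact: real_subspaceB|].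
by have := xN m; rewrite [_ ^+ m.+1]exprSr; lra.
Qed.

Lemma cvg_geometric_half (R : realType) (c : R) :
  c * 2^-1 ^+ n @[n --> \oo] --> (0 : R).
Proof.
by apply: cvg_geometric; rewrite ger0_norm ?invr_ge0 // invf_lt1 // ltr1n.
Qed.

Section SemigroupBound.
Variables (R : realType) (k : scalar_kind).
Variables (X : completeNormedModType (scalar_field R k)).
Variable T : R -> {linear X -> X}.
Hypothesis C0T : C0_semigroup T.

(** Otherwise there are times t_n -> 0+ at which T(t_n) has norm above n + 1. But T(t_n) x -> x for
    every x, so this family is pointwise bounded, hence uniformly bounded. At t = 0 the operator is
    the identity, which is why the times can be taken positive. *)
Lemma C0_semigroup_bound_near0 : exists2 d : R, 0 < d &
  exists2 M, 1 <= M & forall t, 0 <= t <= d ->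
    forall x, rnorm (T t x) <= M * rnorm x.
Proof.
case: C0T => Tc T0 _ T0c; apply: contrapT => H.
have {}H (n : nat) : exists tx : R * X,
    0 < tx.1 <= n.+1%:R^-1 /\ n.+1%:R * rnorm tx.2 < rnorm (T tx.1 tx.2).
  apply: contrapT => Hn; apply: H; exists n.+1%:R^-1; first by rewrite invr_gt0.
  exists n.+1%:R => [|t /andP[t0 tn] x]; first by rewrite ler1n.
  move: t0; rewrite le_eqVlt => /orP[/eqP <-|t0].
    by rewrite T0 ler_peMl ?rnorm_ge0 // ler1n.
  by rewrite leNgt; apply/negP => h; apply: Hn; exists (t, x); rewrite /= t0.
have {H}[tx H] := choice H; pose tt n := (tx n).1.
have tt0 : tt n @[n --> \oo] --> (0 : R)^'+.
  have tt0 : tt n @[n --> \oo] --> (0 : R).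
    apply: (@squeeze_cvgr _ _ _ _ (fun=> 0) (fun n => n.+1%:R^-1)).
    - by apply: nearW => n; have [/andP[/ltW -> ->]] := H n.
    - exact: cvg_cst.
    - exact: cvg_harmonic.
  move=> A /= [e e0 eA]; move/cvgrPdist_lt : tt0 => /(_ _ e0); rewrite !near_simpl.
  apply: filterS => n /= h; have := eA _ h; apply.
  by have [/andP[]] := H n.
have SS : real_subspace [set: X] by [].
have sN (L : {linear X -> X}) : seminorm_on [set: X] (fun x => rnorm (L x)).
  split=> [x y _ _|r x _]; first by rewrite linearD rnormD.
  by rewrite linearZ rnormZr.
have sn : seminorm_on [set: X] (fun x => rnorm x).
  by split=> [x y _ _|r x _]; rewrite ?rnormD ?rnormZr.
have gN n : exists c, forall x, [set: X] x -> rnorm (T (tt n) x) <= c * rnorm x.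
  have [/andP[tn _] _] := H n.
  by have [c _ cH] := continuous_linear_bound (Tc _ (ltW tn)); exists c.
have [||C _ CH] := gliding_hump SS sn (fun n => sN (T (tt n))) gN => //.
  move=> x i _ xN big.
  have tl := seminorm_geometric_tail SS sn (fun=> Logic.I) xN.
  have /cvg_ex[y xy] : cvgn x.
    by apply: rnorm_complete tl _; exact: cvg_geometric_half.
  have gy n : n%:R <= rnorm (T (tt (i n)) y).
    have : rnorm (T (tt (i n)) (x m)) @[m --> \oo] --> rnorm (T (tt (i n)) y).
      apply: cvg_rnorm; apply: continuous_cvg xy.
      by apply: Tc; have [/andP[/ltW]] := H (i n).
    by move/cvgr_to_ge; apply; exists n => //= m; exact: big.
  have : rnorm (T (tt n) y) @[n --> \oo] --> rnorm y.
    by apply: cvg_rnorm; exact: cvg_comp tt0 (T0c y).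
  move=> /cvgP/cvg_seq_bounded[M [_ /(_ (M + 1))]].
  rewrite ltrDl ltr01 => /(_ isT) MB.
  have := gy (Num.trunc (`|M| + 1)).+1.
  rewrite leNgt => /negP; apply; apply: le_lt_trans (truncnS_gt _).
  apply: le_trans (ler_norm _) _; apply: (le_trans (MB _ I)).
  by rewrite lerD2r ler_norm.
have [_] := H (Num.trunc C).+1; rewrite ltNge => /negP; apply.
apply: (le_trans (CH _ _ Logic.I)); apply: ler_wpM2r; first exact: rnorm_ge0.
by apply/ltW; apply: lt_trans (truncnS_gt _) _; rewrite ltr_nat.
Qed.

(** A time t <= n d is reached in at most n + 1 steps of length at most d, and M >= 1 makes the
    powers of M increase. *)
Lemma C0_semigroup_bound (te : R) : exists2 M, 1 <= M & forall t, 0 <= t <= te ->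
    forall x, rnorm (T t x) <= M * rnorm x.
Proof.
have [d d0 [M M1 MH]] := C0_semigroup_bound_near0.
case: C0T => _ _ Ts _.
suff H n : forall t, 0 <= t <= n%:R * d -> forall x, rnorm (T t x) <= M ^+ n.+1 * rnorm x.
  exists (M ^+ (Num.trunc (te / d)).+2) => [|t /andP[t0 tte] x].
    exact: exprn_ege1.
  by apply: H; rewrite t0 (le_trans tte) // -ler_pdivrMr // ltW // truncnS_gt.
elim: n => [|n IH] t /andP[t0 tn] x.
  by apply: MH; rewrite t0 (le_trans tn) // mul0r ltW.
have [td|dt] := leP t d.
  rewrite (le_trans (MH _ _ _)) ?t0 // ler_wpM2r ?rnorm_ge0 //.
  by rewrite exprS ler_peMr ?exprn_ege1 // (le_trans ler01).
have -> : T t x = T d (T (t - d) x) by rewrite -Ts ?subr_ge0 ?ltW // addrC subrK.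
rewrite exprS -mulrA.
rewrite (le_trans (MH _ _ _)) ?(ltW d0) //= ler_wpM2l ?(le_trans ler01) //.
apply: IH; rewrite subr_ge0 (ltW dt) /= lerBlDr; move: tn.
by rewrite -natr1 mulrDl mul1r.
Qed.

End SemigroupBound.

(** * Simple functions *)

Section FiniteRange.
Variable R : realType.
Local Notation mu := (@lebesgue_measure R).

(* vsimple is the case of a normed codomain; pairs of simple functions need
   codomains without a norm. *)
Definition finite_range (W : Type) (s : R -> W) : Prop :=
  finite_set (range s) /\ forall w, measurable (s @^-1` [set w]).

(** The set A is arbitrary: only the finitely many values of s in A matter, and each has a
    measurable level set. *)
Lemma finite_range_preimage (W : Type) (s : R -> W) (A : set W) :
  finite_range s -> measurable (s @^-1` A).
Proof.
move=> [fs ms].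
have -> : s @^-1` A = \bigcup_(w in range s `&` A) s @^-1` [set w].
  by apply/seteqP; split=> [t At|t [w [_ Aw]] /= ->//]; exists (s t).
by apply: fin_bigcup_measurable => //; exact: finite_setIl.
Qed.

Lemma finite_range_comp (W W' : Type) (h : W -> W') (s : R -> W) :
  finite_range s -> finite_range (h \o s).
Proof.
move=> fs; split=> [|w].
  have -> : range (h \o s) = h @` range s by rewrite image_comp.
  exact: finite_image (proj1 fs).
exact: (finite_range_preimage (h @^-1` [set w])).
Qed.

Lemma finite_range_pair (W W' : Type) (s : R -> W) (s' : R -> W') :
  finite_range s -> finite_range s' -> finite_range (fun t => (s t, s' t)).
Proof.
move=> [fs ms] [fs' ms']; split=> [|[w w']].
  apply: (@sub_finite_set _ _ (range s `*` range s')); last exact: finite_setX.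
  by move=> _ [t _ <-]; split; exists t.
have -> : (fun t => (s t, s' t)) @^-1` [set (w, w')] =
    s @^-1` [set w] `&` s' @^-1` [set w'].
  by apply/seteqP; split=> t /= [-> ->].
exact: measurableI.
Qed.

Lemma finite_range_cst (W : Type) (w : W) : finite_range (fun=> w).
Proof.
split=> [|w']; first by apply: (@sub_finite_set _ _ [set w]) => // _ [t _ <-].
by rewrite preimage_cst; case: ifP.
Qed.

Lemma finite_range_mem (D : set R) : measurable D -> finite_range (fun t => t \in D).
Proof.
move=> mD; split=> [|b]; first exact: finite_finset.
case: b.
  by have -> : (fun t => t \in D) @^-1` [set true] = D by
    apply/seteqP; split=> t /= => [/set_mem|/mem_set].
have -> : (fun t => t \in D) @^-1` [set false] = ~` D; last exact: measurableC.
by apply/seteqP; split=> t /= => [|Dt]; [move/negbT; rewrite notin_setE | apply/negbTE; rewrite notin_setE].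
Qed.

Lemma finite_range_patch (W : Type) (w : W) (D : set R) (s : R -> W) : measurable D ->
  finite_range s -> finite_range (patch (fun=> w) D s).
Proof.
move=> mD fs; have := finite_range_pair (finite_range_mem mD) fs.
exact: (@finite_range_comp _ _ (fun bw => if bw.1 then bw.2 else w)).
Qed.

Variable D : set R.
Hypotheses (mD : measurable D) (Dfin : (mu D < +oo)%E).

Definition weight (W : Type) (s : R -> W) (w : W) : R := fine (mu (D `&` s @^-1` [set w])).

Lemma weightE (W : Type) (s : R -> W) w : finite_range s ->
  mu (D `&` s @^-1` [set w]) = (weight s w)%:E.
Proof.
move=> [_ ms]; rewrite fineK // ge0_fin_numE //; apply: le_lt_trans Dfin.
have mDs : measurable (D `&` s @^-1` [set w]) by exact: measurableI.
by apply: le_measure; [exact: mem_set|exact: mem_set|exact: subIsetl].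
Qed.

Lemma weight_ge0 (W : Type) (s : R -> W) w : 0 <= weight s w.
Proof. exact: fine_ge0. Qed.

Lemma weight_comp (W W' : choiceType) (h : W -> W') (s : R -> W) (w' : W') :
  finite_range s ->
  weight (h \o s) w' =
    \sum_(w <- fset_set (range s)) if h w == w' then weight s w else 0.
Proof.
move=> fs; apply: EFin_inj; rewrite -(weightE _ (finite_range_comp h fs)).
have -> : D `&` (h \o s) @^-1` [set w'] =
    \bigcup_(w in range s `&` [set w | h w = w']) (D `&` s @^-1` [set w]).
  apply/seteqP; split=> [t [Dt /= ht]|t [w [_ /= hw] [Dt /= sw]]].
    by exists (s t) => //; split=> //; exists t.
  by split=> //=; rewrite sw.
have fr : finite_set (range s `&` [set w | h w = w']).
  by apply: finite_setIl; exact: (proj1 fs).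
rewrite measure_fin_bigcup //; last 2 first.
- by move=> w1 w2 _ _ [t /= [[_ /= <-] [_ /= <-]]].
- by move=> w _; apply: measurableI => //; exact: (proj2 fs).
rewrite fsbig_mkcondr fsbig_finite; last exact: (proj1 fs).
rewrite -sumEFin; apply: eq_bigr => w _.
have -> : (w \in [set w | h w = w']) = (h w == w').
  by apply/idP/eqP => [/set_mem//|e]; exact: mem_set.
by case: ifP => // _; exact: weightE.
Qed.

Lemma integral_finite_range (W : choiceType) (h : W -> R) (s : R -> W) :
  finite_range s -> (forall w, 0 <= h w) ->
  (\int[mu]_(t in D) (h (s t))%:E)%E =
    (\sum_(w <- fset_set (range s)) weight s w * h w)%:E.
Proof.
move=> fs h0; have fr : finite_set (range s) by exact: (proj1 fs).
transitivity (\int[mu]_(t in D) (\sum_(w \in range s)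
    (h w)%:E * (\1_(s @^-1` [set w]) t)%:E))%E.
  apply: eq_integral => t _; rewrite (fsbigD1 (s t)) //=; last by exists t.
  rewrite indicE mem_set // mule1 fsbig1 ?adde0 // => w /= [_ wt].
  by rewrite indicE memNset ?mule0 // => /= e; apply: wt.
have mi w : measurable_fun D (EFin \o (\1_(s @^-1` [set w]) : R -> R)).
  apply/measurable_EFinP; apply: measurable_indic; by exact: (proj2 fs).
rewrite ge0_integral_fsum //; last 2 first.
- by move=> w; apply: measurable_funeM; exact: mi.
- by move=> w t _; rewrite mule_ge0 ?lee_fin.
rewrite fsbig_finite // -sumEFin; apply: eq_bigr => w _.
rewrite ge0_integralZl //=; [|exact: mi|by rewrite lee_fin].
rewrite integral_indic //; last exact: (proj2 fs).
by rewrite (setIC _ D) EFinM muleC -weightE.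
Qed.

End FiniteRange.

Section SimpleIntegral.
Variables (R : realType) (k : scalar_kind).
Local Notation mu := (@lebesgue_measure R).
Variable D : set R.
Hypotheses (mD : measurable D) (Dfin : (mu D < +oo)%E).

(* Refining the level sets of h \o s to those of s makes the additivity of
   the integral a termwise identity for s = (s1, s2). *)
Lemma simple_integral_comp (W : choiceType) (V : normedModType (scalar_field R k))
    (h : W -> V) (s : R -> W) : finite_range s ->
  simple_integral D (h \o s) =
    \sum_(w <- fset_set (range s)) of_real k (weight D s w) *: h w.
Proof.
move=> fs; have fhs := finite_range_comp h fs.
rewrite /simple_integral fsbig_finite; last by case: fhs.
transitivity (\sum_(v <- fset_set (range (h \o s))) \sum_(w <- fset_set (range s))
    (if h w == v then of_real k (weight D s w) *: v else 0)).
  apply: eq_bigr => v _; rewrite -/(weight D (h \o s) v) weight_comp //.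
  rewrite (big_morph _ (@of_realD R k) (of_real0 R k)) scaler_suml.
  by apply: eq_bigr => w _; case: ifP => // _; rewrite of_real0 scale0r.
rewrite exchange_big /= big_seq [RHS]big_seq; apply: eq_bigr => w.
rewrite in_fset_set; last exact: (proj1 fs).
move=> /set_mem[t _ stw].
have hw : h w \in fset_set (range (h \o s)).
  rewrite in_fset_set; last exact: (proj1 fhs).
  by apply: mem_set; exists t => //=; rewrite stw.
rewrite (big_rem _ hw) /= eqxx big1_seq ?addr0 // => v /andP[_].
by rewrite mem_rem_uniq ?fset_uniq // inE => /andP[/negbTE + _]; rewrite eq_sym => ->.
Qed.

Variable V : normedModType (scalar_field R k).
Implicit Types s : R -> V.

Lemma simple_integralE s : vsimple s -> simple_integral D s =
  \sum_(v <- fset_set (range s)) of_real k (weight D s v) *: v.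
Proof. by move=> fs; have := simple_integral_comp idfun fs. Qed.

Lemma simple_integralD s1 s2 : vsimple s1 -> vsimple s2 ->
  simple_integral D (fun t => s1 t + s2 t) = simple_integral D s1 + simple_integral D s2.
Proof.
move=> f1 f2; have fs := finite_range_pair f1 f2.
have /= -> := simple_integral_comp (fun w : V * V => w.1 + w.2) fs.
have /= -> := simple_integral_comp (fun w : V * V => w.1) fs.
have /= -> := simple_integral_comp (fun w : V * V => w.2) fs.
by rewrite -big_split; apply: eq_bigr => w _; rewrite scalerDr.
Qed.

Lemma simple_integral_linear (W : normedModType (scalar_field R k))
    (L : {linear V -> W}) s : vsimple s ->
  simple_integral D (L \o s) = L (simple_integral D s).
Proof.
move=> fs; rewrite simple_integral_comp // simple_integralE // linear_sum.
by apply: eq_bigr => v _; rewrite linearZ.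
Qed.

Lemma simple_integralN s : vsimple s ->
  simple_integral D (fun t => - s t) = - simple_integral D s.
Proof. by move=> fs; have /= := simple_integral_linear (-%R : {linear V -> V}) fs. Qed.

Lemma simple_integralB s1 s2 : vsimple s1 -> vsimple s2 ->
  simple_integral D (fun t => s1 t - s2 t) = simple_integral D s1 - simple_integral D s2.
Proof.
move=> f1 f2; rewrite simple_integralD ?simple_integralN //.
exact: (finite_range_comp (-%R) f2).
Qed.

Lemma rnorm_simple_integral s : vsimple s ->
  ((rnorm (simple_integral D s))%:E <= \int[mu]_(t in D) (rnorm (s t))%:E)%E.
Proof.
move=> fs; rewrite simple_integralE // (integral_finite_range mD Dfin fs) //.
  rewrite lee_fin; apply: le_trans (rnorm_sum _ _ _) _.
  by apply: ler_sum => v _; rewrite rnormZr ger0_norm // weight_ge0.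
exact: rnorm_ge0.
Qed.

Lemma simple_integral_fin s : vsimple s ->
  (\int[mu]_(t in D) (rnorm (s t))%:E < +oo)%E.
Proof.
move=> fs; rewrite (integral_finite_range mD Dfin fs) ?ltry //; exact: rnorm_ge0.
Qed.

End SimpleIntegral.

(** * The Bochner integral *)

Section StrongMeasurability.
Variables (R : realType) (k : scalar_kind).
Implicit Types V W U : normedModType (scalar_field R k).

Lemma finite_range_measurable (s : R -> R) D : finite_range s -> measurable_fun D s.
Proof.
move=> fs mD Y _; apply: measurableI => //.
exact: finite_range_preimage.
Qed.

Lemma strongly_measurable_rnorm V D (f : R -> V) : measurable D ->
  strongly_measurable D f -> measurable_fun D (fun t => rnorm (f t)).
Proof.
move=> mD [s [fs sf]].
apply: (@measurable_fun_cvg _ _ _ _ (fun n t => rnorm (s n t))) => [n|t Dt].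
  by apply: finite_range_measurable; have := finite_range_comp (@rnorm _ _ V) (fs n).
by apply: cvg_rnorm; exact: sf.
Qed.

Lemma strongly_measurable_Ernorm V D (f : R -> V) : measurable D ->
  strongly_measurable D f -> measurable_fun D (fun t => (rnorm (f t))%:E).
Proof. by move=> mD mf; apply/measurable_EFinP; exact: strongly_measurable_rnorm. Qed.

(** A function of two simple functions is simple, so joint sequential continuity of h is enough.
    Sums, bounded operators and the bilinear map F are all instances. *)
Lemma strongly_measurable_comp2 V W U D (h : V -> W -> U) (f : R -> V) (g : R -> W) :
  (forall (u : V^nat) (w : W^nat) a b, u n @[n --> \oo] --> a -> w n @[n --> \oo] --> b ->
    h (u n) (w n) @[n --> \oo] --> h a b) ->
  strongly_measurable D f -> strongly_measurable D g ->
  strongly_measurable D (fun t => h (f t) (g t)).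
Proof.
move=> hc [s [fs sf]] [s' [fs' sf']].
exists (fun n t => h (s n t) (s' n t)); split=> [n|t Dt].
  exact: (finite_range_comp (fun w : V * W => h w.1 w.2) (finite_range_pair (fs n) (fs' n))).
by apply: hc; [exact: sf|exact: sf'].
Qed.

Lemma vsimple_strongly_measurable V D (s : R -> V) : vsimple s -> strongly_measurable D s.
Proof. by move=> fs; exists (fun=> s); split=> // t _; exact: cvg_cst. Qed.

Lemma strongly_measurableD V D (f g : R -> V) : strongly_measurable D f ->
  strongly_measurable D g -> strongly_measurable D (fun t => f t + g t).
Proof. by apply: strongly_measurable_comp2 => u w a b; exact: cvgD. Qed.

Lemma strongly_measurableB V D (f g : R -> V) : strongly_measurable D f ->
  strongly_measurable D g -> strongly_measurable D (fun t => f t - g t).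
Proof. by apply: (@strongly_measurable_comp2 _ _ _ _ (fun x y => x - y)) => u w a b; exact: cvgB. Qed.

Lemma strongly_measurable_op V W D (L : {linear V -> W}) (f : R -> V) : continuous L ->
  strongly_measurable D f -> strongly_measurable D (fun t => L (f t)).
Proof.
move=> cL mf; apply: (@strongly_measurable_comp2 _ _ _ _ (fun x _ => L x) _ _ _ mf mf).
by move=> u w a b ua _; apply: continuous_cvg ua; exact: cL.
Qed.

Lemma strongly_measurableS V D D' (f : R -> V) : D' `<=` D ->
  strongly_measurable D f -> strongly_measurable D' f.
Proof. by move=> DD' [s [fs sf]]; exists s; split=> // t /DD'; exact: sf. Qed.

Lemma eq_strongly_measurable V D (f g : R -> V) : {in D, f =1 g} ->
  strongly_measurable D f -> strongly_measurable D g.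
Proof.
move=> fg [s [fs sf]]; exists s; split=> // t Dt; by rewrite -(fg _ (mem_set Dt)); exact: sf.
Qed.

Lemma strongly_measurable_patch V D D' (f : R -> V) : measurable D ->
  strongly_measurable D f -> strongly_measurable D' (patch (fun=> 0) D f).
Proof.
move=> mD [s [fs sf]]; exists (fun n => patch (fun=> 0) D (s n)); split=> [n|t _].
  exact: (finite_range_patch 0 mD (fs n)).
rewrite /patch.
by case: ifPn => [/set_mem/sf//|_]; exact: cvg_cst.
Qed.

End StrongMeasurability.

Section BochnerIntegral.
Variables (R : realType) (k : scalar_kind).
Local Notation mu := (@lebesgue_measure R).
Variable D : set R.
Hypotheses (mD : measurable D) (Dfin : (mu D < +oo)%E).
Implicit Types V W : normedModType (scalar_field R k).

Definition L1dist V (f g : R -> V) : \bar R := (\int[mu]_(t in D) (rnorm (f t - g t))%:E)%E.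

Lemma L1dist_ge0 V (f g : R -> V) : (0 <= L1dist f g)%E.
Proof. by apply: integral_ge0 => t _; rewrite lee_fin rnorm_ge0. Qed.

Lemma L1dist_triangle V (f g h : R -> V) : strongly_measurable D f ->
  strongly_measurable D g -> strongly_measurable D h ->
  (L1dist f h <= L1dist f g + L1dist g h)%E.
Proof.
move=> mf mg mh; rewrite /L1dist -ge0_integralD //; first apply: ge0_le_integral => //.
- by move=> t _; rewrite lee_fin rnorm_ge0.
- by apply: strongly_measurable_Ernorm => //; exact: strongly_measurableB.
- by apply: emeasurable_funD; apply: strongly_measurable_Ernorm => //; exact: strongly_measurableB.
- move=> t _; rewrite -EFinD lee_fin.
  have -> : f t - h t = (f t - g t) + (g t - h t) by rewrite addrA subrK.
  exact: rnormD.
- by move=> t _; rewrite lee_fin rnorm_ge0.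
- by apply: strongly_measurable_Ernorm => //; exact: strongly_measurableB.
- by move=> t _; rewrite lee_fin rnorm_ge0.
- by apply: strongly_measurable_Ernorm => //; exact: strongly_measurableB.
Qed.

Lemma L1distC V (f g : R -> V) : L1dist f g = L1dist g f.
Proof. by apply: eq_integral => t _; rewrite rnormBC. Qed.

(** On a set of finite measure simple functions are integrable, which disposes of one clause of the
    definition. *)
Lemma bochner_intro V (f : R -> V) (s : nat -> R -> V) I : strongly_measurable D f ->
  (forall n, vsimple (s n)) -> L1dist f (s n) @[n --> \oo] --> 0%E ->
  simple_integral D (s n) @[n --> \oo] --> I -> is_bochner_integral D f I.
Proof.
by move=> mf fs fsn sI; split=> //; exists s; split=> // n; exact: simple_integral_fin.
Qed.

Lemma simple_integral_dist V (s s' : R -> V) : vsimple s -> vsimple s' ->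
  ((rnorm (simple_integral D s - simple_integral D s'))%:E <= L1dist s s')%E.
Proof.
move=> fs fs'; rewrite -simple_integralB //; apply: rnorm_simple_integral => //.
exact: (finite_range_comp (fun w : V * V => w.1 - w.2) (finite_range_pair fs fs')).
Qed.

Lemma cvge0_squeeze (u v : (\bar R)^nat) : (forall n, 0 <= u n)%E ->
  (forall n, u n <= v n)%E -> v n @[n --> \oo] --> 0%E -> u n @[n --> \oo] --> 0%E.
Proof.
move=> u0 uv v0; apply: (@squeeze_cvge _ _ _ _ (fun=> 0%E) u v) => //.
  by apply: nearW => n; rewrite u0 uv.
exact: cvg_cst.
Qed.

Lemma cvge0D (u v : (\bar R)^nat) : u n @[n --> \oo] --> 0%E ->
  v n @[n --> \oo] --> 0%E -> (u n + v n)%E @[n --> \oo] --> 0%E.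
Proof. by move=> u0 v0; rewrite -[X in _ --> X]adde0; exact: cvgeD. Qed.

Lemma cvge0_rnorm V (u : V^nat) (I : V) (e : (\bar R)^nat) :
  (forall n, (rnorm (u n - I))%:E <= e n)%E -> e n @[n --> \oo] --> 0%E ->
  u n @[n --> \oo] --> I.
Proof.
move=> ue e0; apply/cvg_rnormP.
have /fine_cvgP[] : (rnorm (u n - I))%:E @[n --> \oo] --> 0%:E.
  by apply: cvge0_squeeze ue e0 => n; rewrite lee_fin rnorm_ge0.
by move=> _; apply: cvg_trans; apply: near_eq_cvg; exact: nearW.
Qed.

(** Two approximating sequences are close to each other in L^1, hence so are their integrals: the
    value I does not depend on the sequence. Uniqueness of the integral follows. *)
Lemma bochner_approx V (f : R -> V) I (s : nat -> R -> V) : is_bochner_integral D f I ->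
  (forall n, vsimple (s n)) -> L1dist f (s n) @[n --> \oo] --> 0%E ->
  simple_integral D (s n) @[n --> \oo] --> I.
Proof.
move=> [mf [s' [fs' _ fsn' sI']]] fs fsn.
have -> : (fun n => simple_integral D (s n)) = (fun n =>
    (simple_integral D (s n) - simple_integral D (s' n)) + simple_integral D (s' n)).
  by apply/funext => n; rewrite subrK.
rewrite -[I]add0r.
apply: cvgD sI'; apply: (@cvge0_rnorm _ _ _ (fun n => L1dist f (s n) + L1dist f (s' n))%E).
  move=> n; rewrite subr0; apply: le_trans (simple_integral_dist (fs n) (fs' n)) _.
  rewrite (L1distC f (s n)); apply: L1dist_triangle => //; exact: vsimple_strongly_measurable.
exact: cvge0D.
Qed.

Lemma bochner_unique V (f : R -> V) I J :
  is_bochner_integral D f I -> is_bochner_integral D f J -> I = J.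
Proof.
move=> fI [mf [s [fs _ fsn sJ]]].
apply: (@cvg_unique _ _ (simple_integral D (s n) @[n --> \oo])) => //.
exact: bochner_approx fI fs fsn.
Qed.

Lemma bochner_rnorm_le V (f : R -> V) I : is_bochner_integral D f I ->
  ((rnorm I)%:E <= \int[mu]_(t in D) (rnorm (f t))%:E)%E.
Proof.
move=> [mf [s [fs _ fsn sI]]].
apply: (@lee_cvg_to _ \oo _ _ (fun n => (rnorm (simple_integral D (s n)))%:E)
   (fun n => (\int[mu]_(t in D) (rnorm (f t))%:E) + L1dist f (s n))%E).
- by apply: cvg_EFin; [exact: nearW|exact: cvg_rnorm].
- by rewrite -[X in _ --> X]adde0; apply: cvgeD => //; [rewrite fin_num_adde_defl|exact: cvg_cst].
- apply: nearW => n; apply: le_trans (rnorm_simple_integral mD Dfin (fs n)) _.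
  have ms := vsimple_strongly_measurable D (fs n).
  have m0 := vsimple_strongly_measurable D (finite_range_cst R (0 : V)).
  (* The distance to the zero function is the integral of the norm. *)
  have := L1dist_triangle ms mf m0; rewrite /L1dist.
  under eq_integral do rewrite subr0.
  under [X in (_ <= _ + X)%E -> _]eq_integral do rewrite subr0.
  by rewrite addeC -/(L1dist _ _) L1distC.
Qed.

Lemma bochnerD V (f g : R -> V) I J : is_bochner_integral D f I ->
  is_bochner_integral D g J -> is_bochner_integral D (fun t => f t + g t) (I + J).
Proof.
move=> [mf [s [fs _ fsn sI]]] [mg [s' [fs' _ gsn sJ]]].
have fss n := finite_range_comp (fun w : V * V => w.1 + w.2) (finite_range_pair (fs n) (fs' n)).
apply: (@bochner_intro _ _ (fun n t => s n t + s' n t)) => //.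
- exact: strongly_measurableD.
- apply: cvge0_squeeze (cvge0D fsn gsn) => n; first exact: L1dist_ge0.
  rewrite -ge0_integralD //; first apply: ge0_le_integral => //.
  + by move=> t _; rewrite lee_fin rnorm_ge0.
  + apply: strongly_measurable_Ernorm => //; apply: strongly_measurableB.
      exact: strongly_measurableD.
    exact: vsimple_strongly_measurable (fss n).
  + apply: emeasurable_funD; apply: strongly_measurable_Ernorm => //; apply: strongly_measurableB => //;
    exact: vsimple_strongly_measurable.
  + move=> t _; rewrite -EFinD lee_fin.
    by rewrite opprD addrACA rnormD.
  + by move=> t _; rewrite lee_fin rnorm_ge0.
  + by apply: strongly_measurable_Ernorm => //; apply: strongly_measurableB => //; exact: vsimple_strongly_measurable.
  + by move=> t _; rewrite lee_fin rnorm_ge0.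
  + by apply: strongly_measurable_Ernorm => //; apply: strongly_measurableB => //; exact: vsimple_strongly_measurable.
- under eq_fun do rewrite simple_integralD //.
  exact: cvgD.
Qed.

Lemma bochner_op V W (L : {linear V -> W}) (f : R -> V) I : continuous L ->
  is_bochner_integral D f I -> is_bochner_integral D (fun t => L (f t)) (L I).
Proof.
move=> cL [mf [s [fs _ fsn sI]]]; have [C C0 LC] := continuous_linear_bound cL.
have fLs n := finite_range_comp L (fs n).
apply: (@bochner_intro _ _ (fun n t => L (s n t))) => //.
- exact: strongly_measurable_op.
- apply: (@cvge0_squeeze _ (fun n => C%:E * L1dist f (s n))%E) => [n|n|].
  + exact: L1dist_ge0.
  + have mfs : measurable_fun D (fun t => (rnorm (f t - s n t))%:E).
      apply: strongly_measurable_Ernorm => //; apply: strongly_measurableB => //.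
      exact: vsimple_strongly_measurable.
    rewrite /L1dist -ge0_integralZl //; last 2 first.
      by move=> t _; rewrite lee_fin rnorm_ge0.
      by rewrite lee_fin ltW.
    apply: ge0_le_integral => //.
    * by move=> t _; rewrite lee_fin rnorm_ge0.
    * apply: strongly_measurable_Ernorm => //; apply: strongly_measurableB => //.
        exact: strongly_measurable_op.
      exact: vsimple_strongly_measurable (fLs n).
    * exact: measurable_funeM.
    * by move=> t _; rewrite -EFinM lee_fin -linearB LC.
  + by rewrite -[X in _ --> X](mule0 C%:E); apply: cvgeZl.
- under eq_fun do rewrite (simple_integral_linear mD Dfin L (fs _)).
  by apply: continuous_cvg sI; exact: cL.
Qed.

Lemma bochnerB V (f g : R -> V) I J : is_bochner_integral D f I ->
  is_bochner_integral D g J -> is_bochner_integral D (fun t => f t - g t) (I - J).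
Proof.
move=> fI gJ; apply: bochnerD => //.
by apply: (@bochner_op _ _ (-%R : {linear V -> V})) gJ => x; apply: cvgN; exact: cvg_id.
Qed.

Lemma eq_bochner V (f g : R -> V) I : {in D, f =1 g} ->
  is_bochner_integral D f I -> is_bochner_integral D g I.
Proof.
move=> fg [mf [s [fs _ fsn sI]]]; apply: (@bochner_intro _ _ s) => //.
  exact: eq_strongly_measurable mf.
apply: cvg_trans fsn; apply: near_eq_cvg; apply: nearW => n.
by apply: eq_integral => t Dt; rewrite fg.
Qed.

Lemma bochner0 V : is_bochner_integral D (fun=> 0 : V) 0.
Proof.
have f0 : vsimple (fun=> 0 : V) by exact: finite_range_cst.
apply: (@bochner_intro _ _ (fun _ _ => 0)) => //; first exact: vsimple_strongly_measurable.
  rewrite /L1dist subr0 rnorm0 integral0; exact: cvg_cst.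
have : simple_integral D (fun=> (0 : V) - 0) = 0 by rewrite simple_integralB // subrr.
by rewrite subr0 => ->; exact: cvg_cst.
Qed.

End BochnerIntegral.

(** * Translation invariance; extension, restriction and translation of Bochner integrals *)

Section Translation.
Variable R : realType.
Local Notation mu := (@lebesgue_measure R).

Lemma measurable_translate (c : R) : measurable_fun [set: R] (fun x : R => x + c).
Proof. by apply: measurable_funD => //; exact: measurable_cst. Qed.

Lemma measurable_translate_preimage c (A : set R) : measurable A ->
  measurable ((fun x => x + c) @^-1` A).
Proof. by move=> mA; rewrite -[X in measurable X]setTI; exact: measurable_translate. Qed.

(* The Lebesgue measure is declared on measurableTypeR R, whose display
   differs from that of R. *)
Let translated (c : R) : {measure set (measurableTypeR R) -> \bar R} :=
  @measure_function_pushforward__canonical__measure_function_Measure _ _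
    (measurableTypeR R) (measurableTypeR R) R mu (fun x : R => x + c) (measurable_translate c).

(** The Lebesgue measure is determined by its values on half-open intervals, and the image measure
    under a translation has the same values there. *)
Lemma lebesgue_measure_translate c (A : set R) : measurable A ->
  mu ((fun x => x + c) @^-1` A) = mu A.
Proof.
move=> mA; rewrite -[LHS]/(translated c A); apply/esym.
apply: (@lebesgue_measure_unique R (translated c)) => // X /ocitvP[->|[[a b] /= ab ->]].
  by rewrite !measure0.
rewrite /pushforward.
have -> : (fun x => x + c) @^-1` `]a, b] = `]a - c, b - c]%classic.
  by apply/seteqP; split=> x /=; rewrite !in_itv /= ltrBlDr lerBrDr.
by rewrite !lebesgue_measure_itv /= !lte_fin ltrD2r ab -!EFinB opprB addrA subrK.
Qed.

Lemma ge0_integral_translate c (A : set R) (f : R -> \bar R) : measurable A ->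
  measurable_fun A f -> (forall x, (0 <= f x)%E) ->
  (\int[mu]_(x in (fun x => (x + c)%R) @^-1` A) f (x + c)%R = \int[mu]_(x in A) f x)%E.
Proof.
move=> mA mf f0.
rewrite -(@ge0_integral_pushforward _ _ (measurableTypeR R) (measurableTypeR R) _ _
  (measurable_translate c) mu A f) //.
apply: (@eq_measure_integral _ _ _ _ mu (translated c)) => B mB _.
exact: lebesgue_measure_translate.
Qed.

End Translation.

Section ChangeOfDomain.
Variables (R : realType) (k : scalar_kind) (V : normedModType (scalar_field R k)).
Local Notation mu := (@lebesgue_measure R).
Local Notation "f 1_ D" := (patch (fun=> 0) D f) (at level 10).

Lemma integral_patch (D1 D2 : set R) (f : R -> V) (h : V -> R) : D1 `<=` D2 -> h 0 = 0 ->
  (\int[mu]_(t in D2) (h (f 1_ D1 t))%:E = \int[mu]_(t in D1) (h (f t))%:E)%E.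
Proof.
move=> D12 h0; rewrite integral_mkcond [RHS]integral_mkcond; apply: eq_integral => t _.
rewrite /patch; case: (boolP (t \in D1)) => [/set_mem D1t|_].
  by rewrite (mem_set (D12 _ D1t)).
by case: ifP => //; rewrite h0.
Qed.

Lemma simple_integral_patch (D1 D2 : set R) (s : R -> V) : measurable D1 -> measurable D2 ->
  (mu D2 < +oo)%E -> D1 `<=` D2 -> vsimple s ->
  simple_integral D2 (s 1_ D1) = simple_integral D1 s.
Proof.
move=> mD1 mD2 D2fin D12 fs.
have D1fin : (mu D1 < +oo)%E by apply: le_lt_trans D2fin; apply: le_measure => //; exact: mem_set.
(* Both integrals are computed on the level sets of the pair (t in [D1], s t). Pairs with flag false
   contribute nothing: the value is 0 on the left, the weight is 0 on the right. *)
have fr := finite_range_pair (finite_range_mem mD1) fs.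
have /= := simple_integral_comp mD2 D2fin (fun w : bool * V => if w.1 then w.2 else 0) fr.
rewrite /comp /= => ->.
have /= := simple_integral_comp mD1 D1fin (fun w : bool * V => w.2) fr.
rewrite /comp /= => ->.
apply: eq_bigr => -[[] v] _ /=.
  congr (of_real k (fine (mu _)) *: _); apply/seteqP; split=> t [Dt /= [tD st]].
    by split; [exact: set_mem|rewrite /= tD st].
  by split; [exact: D12|rewrite /= tD st].
rewrite scaler0 /weight; set A := (X in fine (mu X)).
have -> : A = set0.
  by apply/seteqP; split=> // t [D1t /= [tD _]]; rewrite (mem_set D1t) in tD.
by rewrite measure0 /= of_real0 scale0r.
Qed.

Lemma bochner_extend (D1 D2 : set R) (f : R -> V) I : measurable D1 -> measurable D2 ->
  (mu D2 < +oo)%E -> D1 `<=` D2 ->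
  is_bochner_integral D1 f I -> is_bochner_integral D2 (f 1_ D1) I.
Proof.
move=> mD1 mD2 D2fin D12 [mf [s [fs _ fsn sI]]].
apply: (@bochner_intro _ _ _ mD2 D2fin _ _ (fun n => (s n) 1_ D1)) => //.
- exact: strongly_measurable_patch.
- by move=> n; exact: (finite_range_patch 0 mD1 (fs n)).
- apply: cvg_trans fsn; apply: near_eq_cvg; apply: nearW => n.
  rewrite /L1dist -(integral_patch _ D12) ?rnorm0 //.
  by apply: eq_integral => t _; rewrite /patch; case: ifP => // _; rewrite subr0.
- by under eq_fun do rewrite simple_integral_patch //.
Qed.

(** As f vanishes off [D1], cutting the approximants off outside [D1] only brings them closer to f.
    Their integrals over [D2] therefore still converge to I, and these are integrals over [D1]. *)
Lemma bochner_restrict (D1 D2 : set R) (f : R -> V) I : measurable D1 -> measurable D2 ->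
  (mu D2 < +oo)%E -> D1 `<=` D2 -> (forall t, D2 t -> ~ D1 t -> f t = 0) ->
  is_bochner_integral D2 f I -> is_bochner_integral D1 f I.
Proof.
move=> mD1 mD2 D2fin D12 f0 fI; have [mf [s [fs _ fsn _]]] := fI.
have D1fin : (mu D1 < +oo)%E by apply: le_lt_trans D2fin; apply: le_measure => //; exact: mem_set.
have mfs n : measurable_fun D2 (fun t => (rnorm (f t - s n t))%:E).
  apply: strongly_measurable_Ernorm => //; apply: strongly_measurableB => //.
  exact: vsimple_strongly_measurable.
have fps n : vsimple ((s n) 1_ D1) by exact: (finite_range_patch 0 mD1 (fs n)).
apply: (@bochner_intro _ _ _ mD1 D1fin _ _ s) => //.
- exact: strongly_measurableS mf.
- apply: cvge0_squeeze fsn => n; first exact: L1dist_ge0.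
  apply: ge0_subset_integral => //; first exact: mfs.
  by move=> t _; rewrite lee_fin rnorm_ge0.
- have : simple_integral D2 ((s n) 1_ D1) @[n --> \oo] --> I.
    apply: (bochner_approx mD2 D2fin fI) => //.
    apply: cvge0_squeeze fsn => n; first exact: L1dist_ge0.
    apply: ge0_le_integral => //.
    + by move=> t _; rewrite lee_fin rnorm_ge0.
    + apply: strongly_measurable_Ernorm => //; apply: strongly_measurableB => //.
      exact: vsimple_strongly_measurable (fps n).
    + exact: mfs.
    + move=> t D2t; rewrite lee_fin /patch; case: (boolP (t \in D1)) => //.
      by rewrite notin_setE => D1t; rewrite f0 // subr0 rnorm0 rnorm_ge0.
  by under eq_fun do rewrite simple_integral_patch //.
Qed.

Lemma finite_range_translate (W : Type) (s : R -> W) (c : R) :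
  finite_range s -> finite_range (fun t => s (t + c)).
Proof.
move=> [fs ms]; split=> [|w]; last exact: (measurable_translate_preimage c (ms w)).
by apply: (sub_finite_set _ fs) => _ [t _ <-]; exists (t + c).
Qed.

Lemma strongly_measurable_translate (D : set R) (f : R -> V) (c : R) :
  strongly_measurable D f ->
  strongly_measurable ((fun t => t + c) @^-1` D) (fun t => f (t + c)).
Proof.
move=> [r [fr rf]]; exists (fun n t => r n (t + c)); split=> [n|t /= Dt]; last exact: rf.
exact: (finite_range_translate c (fr n)).
Qed.

Lemma bochner_translate (D : set R) (f : R -> V) I (c : R) : measurable D ->
  (mu D < +oo)%E -> is_bochner_integral D f I ->
  is_bochner_integral ((fun t => t + c) @^-1` D) (fun t => f (t + c)) I.
Proof.
move=> mD Dfin [mf [s [fs _ fsn sI]]].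
have mD' := measurable_translate_preimage c mD.
have fs' n : vsimple (fun t => s n (t + c)) := finite_range_translate c (fs n).
have D'fin : (mu ((fun t => (t + c)%R) @^-1` D) < +oo)%E by rewrite lebesgue_measure_translate.
apply: (@bochner_intro _ _ _ mD' D'fin _ _ (fun n t => s n (t + c))) => //.
- exact: strongly_measurable_translate.
- apply: cvg_trans fsn; apply: near_eq_cvg; apply: nearW => n; apply/esym.
  apply: (@ge0_integral_translate _ c D (fun t => (rnorm (f t - s n t))%:E)) => //.
    apply: strongly_measurable_Ernorm => //; apply: strongly_measurableB => //.
    exact: vsimple_strongly_measurable.
  by move=> t; rewrite lee_fin rnorm_ge0.
- apply: cvg_trans sI; apply: near_eq_cvg; apply: nearW => n.
  rewrite /simple_integral.
  have -> : range (fun t => s n (t + c)) = range (s n).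
    apply/seteqP; split=> v [t _ <-]; first by exists (t + c).
    by exists (t - c) => //; rewrite subrK.
  apply: eq_fsbigr => v _; congr (of_real k (fine _) *: _).
  have mDs : measurable (D `&` s n @^-1` [set v]).
    by apply: measurableI => //; exact: (proj2 (fs n)).
  exact/esym/(lebesgue_measure_translate c mDs).
Qed.

End ChangeOfDomain.

(** * Lebesgue spaces *)

Section LpNorm.
Variables (R : realType) (k : scalar_kind) (p : R).
Hypothesis p1 : 1 <= p.
Local Notation mu := (@lebesgue_measure R).
Implicit Types V W U : normedModType (scalar_field R k).
Implicit Types D : set R.

Let p0 : 0 < p. Proof. exact: lt_le_trans p1. Qed.

Lemma Lp_normE V D (f : R -> V) :
  Lp_norm D p f = ((\int[mu]_(t in D) (rnorm (f t) `^ p)%:E) `^ p^-1)%E.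
Proof.
rewrite /Lp_norm unlock; congr (_ `^ _)%E.
rewrite [RHS]integral_mkcond; apply: eq_integral => t _.
rewrite /patch /=; case: ifP => _; first by rewrite ger0_norm ?rnorm_ge0.
by rewrite normr0 powR0 // gt_eqF.
Qed.

Lemma Lp_norm_ge0 V D (f : R -> V) : (0 <= Lp_norm D p f)%E.
Proof. by rewrite Lp_normE poweR_ge0. Qed.

Lemma eq_Lp_norm V W D (f : R -> V) (g : R -> W) :
  {in D, forall t, rnorm (f t) = rnorm (g t)} -> Lp_norm D p f = Lp_norm D p g.
Proof.
by move=> fg; rewrite !Lp_normE; congr (_ `^ _)%E; apply: eq_integral => t /fg ->.
Qed.

Lemma measurable_rnorm_powR V D (f : R -> V) : measurable D -> strongly_measurable D f ->
  measurable_fun D (fun t => (rnorm (f t) `^ p)%:E).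
Proof.
move=> mD mf; apply/measurable_EFinP.
have := measurableT_comp (measurable_powR p) (strongly_measurable_rnorm mD mf).
exact.
Qed.

Lemma poweR_inv_le (x y : \bar R) : (0 <= x)%E -> (x <= y)%E -> (x `^ p^-1 <= y `^ p^-1)%E.
Proof.
move=> x0 xy; apply: gt0_ler_poweR => //; first by rewrite invr_ge0 ltW.
  by rewrite in_itv /= x0 leey.
by rewrite in_itv /= (le_trans x0) // leey.
Qed.

Lemma poweRK (x : R) : 0 <= x -> (((x `^ p)%:E) `^ p^-1)%E = x%:E.
Proof.
by move=> x0; rewrite poweR_EFin -powRrM mulfV ?gt_eqF // powRr1.
Qed.

Lemma Lp_norm_subset V D D' (f : R -> V) : measurable D -> measurable D' -> D' `<=` D ->
  strongly_measurable D f -> (Lp_norm D' p f <= Lp_norm D p f)%E.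
Proof.
move=> mD mD' D'D mf; rewrite !Lp_normE; apply: poweR_inv_le.
  by apply: integral_ge0 => t _; rewrite lee_fin powR_ge0.
apply: ge0_subset_integral => //; first exact: measurable_rnorm_powR.
by move=> t _; rewrite lee_fin powR_ge0.
Qed.

Lemma Lp_norm_patch V D D' (f : R -> V) : D' `<=` D ->
  Lp_norm D p (patch (fun=> 0) D' f) = Lp_norm D' p f.
Proof.
move=> D'D; rewrite !Lp_normE; congr (_ `^ _)%E.
apply: (integral_patch f (h := fun v => rnorm v `^ p)) => //.
by rewrite rnorm0 powR0 // gt_eqF.
Qed.

Lemma Lp_norm_translate V D (f : R -> V) c : measurable D -> strongly_measurable D f ->
  Lp_norm ((fun t => t + c) @^-1` D) p (fun t => f (t + c)) = Lp_norm D p f.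
Proof.
move=> mD mf; rewrite !Lp_normE; congr (_ `^ _)%E.
apply: (ge0_integral_translate c (f := fun t => (rnorm (f t) `^ p)%:E)) => //.
  exact: measurable_rnorm_powR.
by move=> t; rewrite lee_fin powR_ge0.
Qed.

Lemma Lp_norm_le V W D (f : R -> V) (g : R -> W) a : measurable D ->
  strongly_measurable D f -> strongly_measurable D g -> 0 <= a ->
  (forall t, D t -> rnorm (f t) <= a * rnorm (g t)) ->
  (Lp_norm D p f <= a%:E * Lp_norm D p g)%E.
Proof.
move=> mD mf mg a0 fg; rewrite !Lp_normE -(poweRK a0) -poweRM; last 2 first.
- by rewrite lee_fin powR_ge0.
- by apply: integral_ge0 => t _; rewrite lee_fin powR_ge0.
apply: poweR_inv_le.
  by apply: integral_ge0 => t _; rewrite lee_fin powR_ge0.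
rewrite -ge0_integralZl //; last 3 first.
- exact: measurable_rnorm_powR.
- by move=> t _; rewrite lee_fin powR_ge0.
- by rewrite lee_fin powR_ge0.
apply: ge0_le_integral => //.
- by move=> t _; rewrite lee_fin powR_ge0.
- exact: measurable_rnorm_powR.
- by apply: measurable_funeM; exact: measurable_rnorm_powR.
- move=> t Dt; rewrite -EFinM lee_fin -powRM ?rnorm_ge0 //.
  by apply: ge0_ler_powR => //; rewrite ?nnegrE ?rnorm_ge0 ?(ltW p0) ?mulr_ge0 ?rnorm_ge0 ?fg.
Qed.

(** The scalar Minkowski inequality for the norms. Assuming only a pointwise domination, with three
    codomains, covers sums as well as the reverse form |f| <= |g| + |f - g|. *)
Lemma Lp_norm_minkowski V W U D (f : R -> V) (g : R -> W) (h : R -> U) : measurable D ->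
  strongly_measurable D f -> strongly_measurable D g -> strongly_measurable D h ->
  (forall t, D t -> rnorm (f t) <= rnorm (g t) + rnorm (h t)) ->
  (Lp_norm D p f <= Lp_norm D p g + Lp_norm D p h)%E.
Proof.
move=> mD mf mg mh fgh.
have mr (V' : normedModType (scalar_field R k)) (f' : R -> V') : strongly_measurable D f' ->
    measurable_fun [set: R] ((fun t => rnorm (f' t)) \_ D).
  move=> mf'; apply/(measurable_restrictT _ mD); exact: strongly_measurable_rnorm.
apply: le_trans (minkowski_EFin mu (mr _ _ mg) (mr _ _ mh) p1).
rewrite /Lp_norm !unlock; apply: poweR_inv_le.
  by apply: integral_ge0 => t _; exact: poweR_ge0.
apply: ge0_le_integral => //.
- by move=> t _; exact: poweR_ge0.
- apply: (measurableT_comp (measurable_poweR p)); apply: measurableT_comp => //.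
  by apply/measurable_EFinP; exact: mr.
- apply: (measurableT_comp (measurable_poweR p)); apply: measurableT_comp => //.
  by apply/measurable_EFinP; apply: measurable_funD; exact: mr.
- move=> t _ /=; rewrite /patch; case: ifPn => [/set_mem Dt|_]; last by rewrite addr0.
  rewrite !lee_fin !ger0_norm ?addr_ge0 ?rnorm_ge0 //.
  by apply: ge0_ler_powR => //; rewrite ?nnegrE ?addr_ge0 ?rnorm_ge0 ?(ltW p0) ?fgh.
Qed.

Lemma in_LpZ V D (f : R -> V) (a : scalar_field R k) : measurable D ->
  in_Lp D p f -> in_Lp D p (fun t => a *: f t).
Proof.
move=> mD [mf ff].
have maf : strongly_measurable D (fun t => a *: f t).
  apply: (@strongly_measurable_comp2 _ _ _ _ _ _ (fun x _ => a *: x) _ _ _ mf mf).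
  by move=> u w x y ux _; exact: cvgZr.
split=> //; apply: (le_lt_trans (Lp_norm_le (a := re_part `|a|) mD maf mf _ _)).
- by rewrite -(ler_of_real k) of_real0 re_part_ge0.
- by move=> t _; rewrite rnormZ.
- by rewrite lte_mul_pinfty ?Lp_norm_ge0 // ?lee_fin // -(ler_of_real k) of_real0 re_part_ge0.
Qed.

Lemma Lp_normD V D (f g : R -> V) : measurable D -> strongly_measurable D f ->
  strongly_measurable D g ->
  (Lp_norm D p (fun t => (f t + g t)%R) <= Lp_norm D p f + Lp_norm D p g)%E.
Proof.
move=> mD mf mg; apply: Lp_norm_minkowski => //; first exact: strongly_measurableD.
by move=> t _; exact: rnormD.
Qed.

Lemma Lp_normZ V D (f : R -> V) (r : R) : measurable D -> strongly_measurable D f ->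
  Lp_norm D p (fun t => of_real k r *: f t) = (`|r|%:E * Lp_norm D p f)%E.
Proof.
move=> mD mf; rewrite !Lp_normE -(poweRK (normr_ge0 r)) -poweRM; last 2 first.
- by rewrite lee_fin powR_ge0.
- by apply: integral_ge0 => t _; rewrite lee_fin powR_ge0.
congr (_ `^ _)%E; rewrite -ge0_integralZl //; last 2 first.
- exact: measurable_rnorm_powR.
- by move=> t _; rewrite lee_fin powR_ge0.
by apply: eq_integral => t _; rewrite rnormZr powRM ?rnorm_ge0 // EFinM.
Qed.

Lemma vsimple_Lp_norm V D (s : R -> V) : measurable D -> (mu D < +oo)%E -> vsimple s ->
  (Lp_norm D p s < +oo)%E.
Proof.
move=> mD Dfin fs; rewrite Lp_normE; apply: poweR_lty.
rewrite (integral_finite_range mD Dfin (h := fun v => rnorm v `^ p) fs) ?ltry //.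
by move=> v; exact: powR_ge0.
Qed.

(* On a set of finite measure, |f| <= 1 + |f|^p; apply this to f / r for all
   r > ||f||_p. *)
Lemma L1_le_Lp V D (f : R -> V) : measurable D -> (mu D < +oo)%E ->
  strongly_measurable D f ->
  (\int[mu]_(t in D) (rnorm (f t))%:E <= (fine (mu D) + 1)%:E * Lp_norm D p f)%E.
Proof.
move=> mD Dfin mf; set c := fine _ + 1.
have c0 : 0 < c by rewrite ltr_wpDl // fine_ge0.
have [->|Nfin] := eqVneq (Lp_norm D p f) +oo%E.
  by rewrite gt0_muley ?leey // lte_fin.
have {}Nfin : Lp_norm D p f \is a fin_num.
  by rewrite ge0_fin_numE ?Lp_norm_ge0 // lt_neqAle Nfin leey.
have N0 : 0 <= fine (Lp_norm D p f) by exact: fine_ge0 (Lp_norm_ge0 _ _).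
rewrite -(fineK Nfin); apply/lee_addgt0Pr => e e0.
(* Multiplied by c, the excess e / c over the norm costs exactly e; it also keeps r positive when
   the norm is 0. *)
pose r := fine (Lp_norm D p f) + e / c.
have r0 : 0 < r by rewrite ltr_wpDl // divr_gt0.
have -> : (c%:E * (fine (Lp_norm D p f))%:E + e%:E)%E = (r * c)%:E.
  by rewrite -EFinM -EFinD /r [in RHS]mulrDl divfK ?gt_eqF // mulrC.
have mg := measurable_rnorm_powR mD mf.
have I1 : (\int[mu]_(t in D) (rnorm (f t) `^ p)%:E <= (r `^ p)%:E)%E.
  have := poweR_Lnorm mu (EFin \o ((fun t => rnorm (f t)) \_ D)) (lt0r_neq0 p0).
  rewrite -/(Lp_norm D p f).
  have -> : (\int[mu]_x (`|(EFin \o ((fun t => rnorm (f t)) \_ D)) x| `^ p) =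
     \int[mu]_(t in D) (rnorm (f t) `^ p)%:E)%E.
    rewrite [RHS]integral_mkcond; apply: eq_integral => t _.
    rewrite /patch /=; case: ifP => _; first by rewrite ger0_norm ?rnorm_ge0.
    by rewrite normr0 powR0 // gt_eqF.
  move=> <-; rewrite -(fineK Nfin) poweR_EFin lee_fin.
  by apply: ge0_ler_powR; rewrite ?nnegrE ?(ltW p0) ?(ltW r0) // lerDl divr_ge0 ?ltW.
have rp0 : 0 < r `^ p by rewrite powR_gt0.
apply: (@le_trans _ _ (\int[mu]_(t in D) (r%:E + (r / r `^ p)%:E * (rnorm (f t) `^ p)%:E))%E).
  apply: ge0_le_integral => //.
  - by move=> t _; rewrite lee_fin rnorm_ge0.
  - exact: strongly_measurable_Ernorm.
  - by apply: emeasurable_funD => //; exact: measurable_funeM.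
  - move=> t _; rewrite -EFinM -EFinD lee_fin.
    have [fr|rf] := leP (rnorm (f t)) r.
      by rewrite (le_trans fr) // lerDl mulr_ge0 ?powR_ge0 // divr_ge0 ?ltW.
    apply: ler_wpDl; first exact: ltW.
    have [y fy y1] : exists2 y, rnorm (f t) = r * y & 1 <= y.
      exists (rnorm (f t) / r); first by rewrite mulrC divfK ?gt_eqF.
      by rewrite ler_pdivlMr // mul1r ltW.
    have y0 : 0 <= y by rewrite (le_trans ler01).
    rewrite fy powRM ?(ltW r0) // mulrA divfK ?gt_eqF //.
    by rewrite ler_pM2l // -{1}(powRr1 y0) ler_powR.
rewrite ge0_integralD //; last 3 first.
- by move=> t _; rewrite lee_fin ltW.
- by move=> t _; rewrite -EFinM lee_fin mulr_ge0 ?powR_ge0 // divr_ge0 ?ltW.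
- exact: measurable_funeM.
rewrite integral_cst // ge0_integralZl //; last 2 first.
- by move=> t _; rewrite lee_fin powR_ge0.
- by rewrite lee_fin divr_ge0 ?ltW.
have -> : (r * c)%:E = (r%:E * mu D + r%:E)%E.
  by rewrite -{1}(@fineK _ (mu D)) ?ge0_fin_numE // -EFinM -EFinD /c mulrDr mulr1.
apply: leeD => //; apply: (le_trans (lee_wpmul2l _ I1)).
  by rewrite lee_fin divr_ge0 ?ltW.
by rewrite -EFinM divfK ?gt_eqF.
Qed.

(** Absolute continuity of the integral of |f|^p, at the level e^p. *)
Lemma Lp_norm_absolute_continuity V D (f : R -> V) : measurable D -> in_Lp D p f ->
  forall e : R, 0 < e -> exists2 d : R, 0 < d & forall A, measurable A -> A `<=` D ->
    (mu A < d%:E)%E -> (Lp_norm A p f <= e%:E)%E.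
Proof.
move=> mD [mf ff] e e0; have mfp := measurable_rnorm_powR mD mf.
have fp0 t : D t -> (0 <= (rnorm (f t) `^ p)%:E)%E by rewrite lee_fin powR_ge0.
have Dfin : (\int[mu]_(t in D) (rnorm (f t) `^ p)%:E < +oo)%E.
  by move: ff; rewrite Lp_normE; apply: lty_poweRy; rewrite invr_neq0 // gt_eqF.
have fi : mu.-integrable [set: R] (EFin \o ((fun t => rnorm (f t) `^ p) \_ D)).
  rewrite -restrict_EFin; apply/integrable_restrict => //; rewrite setTI.
  apply/integrableP; split=> //.
  by under eq_integral do rewrite /= ger0_norm ?powR_ge0 //.
have [d [d0 dH]] := integral_normr_continuous fi (powR_gt0 p e0).
exists d => // A mA AD Ad; rewrite Lp_normE -(poweRK (ltW e0)); apply: poweR_inv_le.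
  by apply: integral_ge0 => t _; rewrite lee_fin powR_ge0.
have := dH A mA Ad; rewrite /Rintegral => /ltW.
have -> : (\int[mu]_(t in A) (`|((fun t => rnorm (f t) `^ p) \_ D) t|%R)%:E =
    \int[mu]_(t in A) (rnorm (f t) `^ p)%:E)%E.
  apply: eq_integral => t /set_mem/AD Dt.
  by rewrite /patch mem_set // ger0_norm ?powR_ge0.
rewrite -lee_fin fineK // ge0_fin_numE; last first.
  by apply: integral_ge0 => t _; rewrite lee_fin powR_ge0.
by apply: le_lt_trans Dfin; apply: ge0_subset_integral.
Qed.

End LpNorm.

(** For a > 0 the power is differentiable at a. At a = 0 a squeeze is used instead: p >= 1 gives
    u_n^p <= u_n as soon as u_n <= 1. *)
Lemma cvg_powR (R : realType) (p : R) (u : R^nat) a : 1 <= p -> (forall n, 0 <= u n) ->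
  u n @[n --> \oo] --> a -> u n `^ p @[n --> \oo] --> a `^ p.
Proof.
move=> p1 u0 ua; have p0 : 0 < p by exact: lt_le_trans p1.
have : 0 <= a by apply: cvgr_to_ge ua _; exact: nearW.
rewrite le_eqVlt => /orP[/eqP a0|a0].
  rewrite -a0 in ua *; rewrite powR0 ?gt_eqF //.
  apply: (@squeeze_cvgr _ _ _ _ (fun=> 0) u) => //; last exact: cvg_cst.
  have /cvgrPdist_le /(_ 1 ltr01) := ua; apply: filterS => n.
  rewrite sub0r normrN ger0_norm // => un1.
  rewrite powR_ge0 /=; have := u0 n; rewrite le_eqVlt => /orP[/eqP <-|un0].
    by rewrite powR0 // gt_eqF.
  by rewrite -[leRHS](powRr1 (ltW un0)) ger_powR // un0.
apply: (@continuous_cvg nat R R _ _ u (fun x => x `^ p) a _ ua).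
apply: differentiable_continuous.
apply/derivable1_diffP; apply: derivable_powR.
by rewrite in_itv /= a0.
Qed.

(** * Limits and approximation by simple functions in L^p *)

Section LpLimits.
Variables (R : realType) (k : scalar_kind) (p : R).
Hypothesis p1 : 1 <= p.
Local Notation mu := (@lebesgue_measure R).
Variable D : set R.
Hypotheses (mD : measurable D) (Dfin : (mu D < +oo)%E).

Let p0 : 0 < p. Proof. exact: lt_le_trans p1. Qed.

Lemma limn_einf_le (u : (\bar R)^nat) b : (forall n, u n <= b)%E -> (limn_einf u <= b)%E.
Proof.
move=> ub; rewrite limn_einf_lim; apply: lime_le; first exact: is_cvg_einfs.
apply: nearW => n; apply: le_trans (ub n); apply: ereal_inf_lbound.
by exists n => /=.
Qed.

(** Fatou's lemma for |u_n|^p. *)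
Lemma Lp_norm_lim (V : normedModType (scalar_field R k)) (u : nat -> R -> V) (v : R -> V) (B : R) :
  (forall n, strongly_measurable D (u n)) ->
  (forall t, D t -> u n t @[n --> \oo] --> v t) ->
  (forall n, Lp_norm D p (u n) <= B%:E)%E -> (Lp_norm D p v <= B%:E)%E.
Proof.
move=> mu_ uv uB.
have B0 : 0 <= B by rewrite -lee_fin (le_trans _ (uB 0%N)) // Lp_norm_ge0.
rewrite Lp_normE // -(poweRK p1 B0); apply: poweR_inv_le => //.
  by apply: integral_ge0 => t _; rewrite lee_fin powR_ge0.
have := fatou mu mD (fun n => measurable_rnorm_powR p mD (mu_ n)).
have h n t : D t -> (0 <= (rnorm (u n t) `^ p)%:E)%E by rewrite lee_fin powR_ge0.
move=> /(_ h).
have -> : (\int[mu]_(t in D) limn_einf (fun n => (rnorm (u n t) `^ p)%:E) =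
   \int[mu]_(t in D) (rnorm (v t) `^ p)%:E)%E.
  apply: eq_integral => t /set_mem Dt.
  have c : (rnorm (u n t) `^ p)%:E @[n --> \oo] --> (rnorm (v t) `^ p)%:E.
    apply: cvg_EFin; first exact: nearW.
    apply: cvg_powR => // [m|]; first exact: rnorm_ge0.
    by apply: cvg_rnorm; exact: uv.
  by rewrite (cvg_limn_einf_sup c).1.
move=> /le_trans; apply; apply: limn_einf_le => n.
have := uB n; rewrite Lp_normE // => uBn.
have I0 : (0 <= \int[mu]_(t in D) (rnorm (u n t) `^ p)%:E)%E.
  by apply: integral_ge0 => t _; rewrite lee_fin powR_ge0.
rewrite -[leLHS](poweRe1 I0) -(mulVf (lt0r_neq0 p0)) poweRrM -poweR_EFin.
apply: gt0_ler_poweR => //; first exact: ltW.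
  by rewrite in_itv /= poweR_ge0 leey.
by rewrite in_itv /= lee_fin B0 leey.
Qed.

Lemma rnorm_telescope_le (V : normedModType (scalar_field R k)) (u : V^nat) m n :
  (n <= m)%N -> ((rnorm (u m - u n))%:E <= \sum_(n <= i <oo) (rnorm (u i.+1 - u i))%:E)%E.
Proof.
move=> nm; apply: (@le_trans _ _ (\sum_(n <= i < m) (rnorm (u i.+1 - u i))%:E)%E).
  rewrite sumEFin lee_fin -telescope_sumr //; exact: rnorm_sum.
by apply: nneseries_lim_ge => i _ _; rewrite lee_fin rnorm_ge0.
Qed.

(** The sum g of the norms of the increments is integrable, hence finite almost everywhere. Where it
    is finite the sequence converges and g dominates its distance to the limit. Fatou's lemma puts
    the limit in L^p, and dominated convergence gives the convergence in L^1. *)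
Lemma Lp_geometric_limit (V : completeNormedModType (scalar_field R k)) (x : nat -> R -> V) :
  (forall n, vsimple (x n)) ->
  (forall n, Lp_norm D p (fun t => (x n.+1 t - x n t)%R) <= (2^-1 ^+ n)%:E)%E ->
  exists2 v, in_Lp D p v & L1dist D v (x n) @[n --> \oo] --> 0%E.
Proof.
move=> fx xN; pose d n t := (rnorm (x n.+1 t - x n t))%:E.
have sx n : strongly_measurable D (x n) by exact: vsimple_strongly_measurable.
have md n : measurable_fun D (d n).
  by apply: strongly_measurable_Ernorm => //; exact: strongly_measurableB.
have d0 n t : (0 <= d n t)%E by rewrite lee_fin rnorm_ge0.
pose g t := (\sum_(0 <= n <oo) d n t)%E.
have mg : measurable_fun D g.
  exact: (@ge0_emeasurable_sum _ _ _ D d xpredT).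
have g0 t : (0 <= g t)%E by exact: nneseries_ge0.
pose c := fine (mu D) + 1.
have c0 : 0 < c by rewrite ltr_wpDl // fine_ge0.
have gfin : (\int[mu]_(t in D) g t < +oo)%E.
  rewrite integral_nneseries //.
  apply: (@le_lt_trans _ _ (2 * c)%:E); last exact: ltry.
  (* The n-th term is at most c 2^-n = 2c / 2^(n+1), and these bounds add up to 2c. *)
  apply: le_trans (epsilon_trick0 xpredT (_ : 0 <= 2 * c)); last by rewrite mulr_ge0 // ltW.
  apply: lee_nneseries => n _; first by move=> _; exact: integral_ge0.
  apply: (le_trans (L1_le_Lp p1 mD Dfin (strongly_measurableB (sx n.+1) (sx n)))).
  apply: (le_trans (lee_wpmul2l _ (xN n))); first by rewrite lee_fin ltW.
  rewrite -EFinM lee_fin natrX exprS invfM exprVn -/c [2 * c]mulrC -mulrA.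
  by rewrite [2 * _]mulrA divff // mul1r.
have gint : mu.-integrable D g.
  apply/integrableP; split=> //; under eq_integral do rewrite gee0_abs //.
  exact: gfin.
pose E := D `&` [set t | (g t < +oo)%E].
have mE : measurable E by exact: emeasurable_fun_infty_o.
(* The majorant e is the tail of the series g(t), a real null sequence wherever g(t) is finite. *)
have tailP t : (g t < +oo)%E -> exists2 e : R^nat,
    (forall m n, (n <= m)%N -> rnorm (x m t - x n t) <= e n) /\
    (forall n, ((e n)%:E <= g t)%E) & e n @[n --> \oo] --> 0.
  move=> gt; pose tl n := (\sum_(n <= i <oo) d i t)%E.
  have tl0 n : (0 <= tl n)%E by exact: nneseries_ge0.
  have tlg n : (tl n <= g t)%E.
    rewrite /g (@nneseries_split _ _ 0 n) ?add0n //; apply: leeDr.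
    by apply: sume_ge0.
  have tlE n : tl n = (fine (tl n))%:E.
    by rewrite fineK // ge0_fin_numE // (le_lt_trans (tlg n)).
  exists (fun n => fine (tl n)); [split|].
  - by move=> m n nm; rewrite -lee_fin -tlE; exact: (rnorm_telescope_le (fun n => x n t)).
  - by move=> n; rewrite -tlE.
  - have : tl n @[n --> \oo] --> 0%E by exact: nneseries_tail_cvg.
    by move/fine_cvgP => [].
have xcvg t : E t -> cvgn (fun n => x n t).
  by move=> [_ /tailP[e [e1 _] e2]]; exact: rnorm_complete e1 e2.
pose v t := if t \in E then limn (fun n => x n t) else 0.
have xv t : E t -> x n t @[n --> \oo] --> v t.
  by move=> Et; rewrite /v mem_set //; exact: xcvg.
(* Strong measurability asks for convergence at every point of D, so the sequence is set to 0 off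
   [E], as v is. *)
pose y n := patch (fun=> 0) E (x n).
have fy n : vsimple (y n) by exact: (finite_range_patch 0 mE (fx n)).
have yv t : D t -> y n t @[n --> \oo] --> v t.
  move=> Dt; rewrite /y /patch; case: (boolP (t \in E)) => [/set_mem|tE]; first exact: xv.
  by rewrite /v (negbTE tE); exact: cvg_cst.
have sy n : strongly_measurable D (y n) by exact: vsimple_strongly_measurable.
have sv : strongly_measurable D v by exists y; split.
have ED : E `<=` D by move=> t [].
(* The 2 is the sum of the bounds 2^-n on the increments. *)
pose B := fine (Lp_norm D p (x 0%N)) + 2.
have Nx n : (Lp_norm D p (x n) <= B%:E)%E.
  have : (Lp_norm D p (x n) <= (fine (Lp_norm D p (x 0%N)) + 2 * (1 - 2^-1 ^+ n))%:E)%E.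
    elim: n => [|n IH].
      rewrite expr0 subrr mulr0 addr0 fineK // ge0_fin_numE ?Lp_norm_ge0 //.
      exact: vsimple_Lp_norm.
    have := Lp_norm_minkowski p1 mD (sx n.+1) (sx n) (strongly_measurableB (sx n.+1) (sx n)).
    move=> /(_ (fun t _ => rnorm_dist _ _)) /le_trans; apply.
    apply: (le_trans (leeD IH (xN n))); rewrite -EFinD lee_fin exprSr.
    by set h := _ ^+ n; lra.
  move/le_trans; apply; rewrite lee_fin /B lerD2l.
  by have : 0 <= (2^-1 : R) ^+ n by []; lra.
exists v.
  split=> //; apply: (@le_lt_trans _ _ B%:E); last exact: ltry.
  apply: (Lp_norm_lim (u := y)) => // n; rewrite /y Lp_norm_patch //.
  by apply: le_trans (Nx n); apply: Lp_norm_subset.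
have gae := @integrable_ae _ (measurableTypeR R) R mu D mD g gint.
have msub n : measurable_fun D (fun t => (rnorm (v t - x n t))%:E).
  by apply: strongly_measurable_Ernorm => //; exact: strongly_measurableB.
have [] := @dominated_convergence _ (measurableTypeR R) R mu D mD (fun n t => (rnorm (v t - x n t))%:E)
  (fun=> 0%E) g msub _ _ gint.
- exact: measurable_cst.
- apply: filterS gae => t fg Dt.
  have Et : E t by split => //; rewrite /= ltey_eq fg.
  apply: cvg_EFin; first exact: nearW.
  have /cvg_rnormP := xv t Et; apply: cvg_trans; apply: near_eq_cvg; apply: nearW => n /=.
  by rewrite rnormBC.
- apply: filterS gae => t fg n Dt.
  have Et : E t by split => //; rewrite /= ltey_eq fg.
  rewrite gee0_abs ?lee_fin ?rnorm_ge0 //.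
  have [e [e1 e2] _] := tailP t Et.2; apply: le_trans (e2 n); rewrite lee_fin.
  have : rnorm (x m t - x n t) @[m --> \oo] --> rnorm (v t - x n t).
    by apply: cvg_rnorm; apply: cvgB; [exact: xv|exact: cvg_cst].
  by move/cvgr_to_le; apply; exists n => // m; exact: e1.
- by move=> _ _; rewrite integral0.
Qed.

(** Simple functions converging pointwise to v are set to 0 wherever their norm exceeds 2 |v|. This
    keeps the limit: where v is nonzero the cut is eventually inactive, and where v = 0 the
    truncations vanish. Their distance to v is at most 3 |v|, which is integrable on D, so dominated
    convergence applies. *)
Lemma Lp_simple_approx (V : normedModType (scalar_field R k)) (v : R -> V) : in_Lp D p v ->
  exists s : nat -> R -> V, [/\ forall n, vsimple (s n),
    forall n, (Lp_norm D p (s n) <= 2%:E * Lp_norm D p v)%E &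
    L1dist D v (s n) @[n --> \oo] --> 0%E].
Proof.
move=> [mv fv]; have [r [fr rv]] := mv.
have mrv := strongly_measurable_rnorm mD mv.
have mr n := strongly_measurable_rnorm mD (vsimple_strongly_measurable D (fr n)).
pose A n := D `&` [set t | rnorm (r n t) <= 2 * rnorm (v t)].
have mA n : measurable (A n).
  have := @measurable_fun_le _ _ _ D (fun t => rnorm (r n t)) (fun t => 2 * rnorm (v t)) mD (mr n).
  by apply; apply: measurable_funM => //; exact: measurable_cst.
pose s n := patch (fun=> 0) (A n) (r n).
have fs n : vsimple (s n) by exact: (finite_range_patch 0 (mA n) (fr n)).
have sv n t : D t -> rnorm (s n t) <= 2 * rnorm (v t).
  move=> Dt; rewrite /s /patch; case: ifPn => [/set_mem[]//|_].
  by rewrite rnorm0 mulr_ge0 ?rnorm_ge0.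
have ss n : strongly_measurable D (s n) by exact: vsimple_strongly_measurable.
exists s; split=> // [n|]; first by apply: Lp_norm_le => // t; exact: sv.
have vint : mu.-integrable D (fun t => (3 * rnorm (v t))%:E).
  have mv3 : measurable_fun D (fun t => (3 * rnorm (v t))%:E).
    by apply/measurable_EFinP; apply: measurable_funM => //; exact: measurable_cst.
  apply/integrableP; split=> //.
  under eq_integral do rewrite gee0_abs ?lee_fin ?mulr_ge0 ?rnorm_ge0 // EFinM.
  rewrite ge0_integralZl //; last 2 first.
  - exact: strongly_measurable_Ernorm.
  - by move=> t _; rewrite lee_fin rnorm_ge0.
  rewrite lte_mul_pinfty ?lee_fin //.
  apply: (le_lt_trans (L1_le_Lp p1 mD Dfin mv)); rewrite lte_mul_pinfty ?lee_fin //.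
  by rewrite addr_ge0 // fine_ge0.
rewrite -[X in _ --> X](integral0 mu D).
apply: (@dominated_cvg _ (measurableTypeR R) R mu D mD _ _ (fun t => (3 * rnorm (v t))%:E)) => //.
- by move=> n; apply: strongly_measurable_Ernorm => //; exact: strongly_measurableB.
- move=> t Dt; apply: cvg_EFin; first exact: nearW.
  have rvt := rv t Dt; have [v0|v0] := eqVneq (rnorm (v t)) 0.
    apply: cvg_near_cst; apply: nearW => n /=.
    have := sv n t Dt; rewrite v0 mulr0 => s0.
    by rewrite (rnorm0_eq0 v0) sub0r rnormN; apply/eqP; rewrite eq_le s0 rnorm_ge0.
  have vt0 : 0 < rnorm (v t) by rewrite lt_neqAle eq_sym v0 rnorm_ge0.
  have /cvg_rnormP/cvgrPdist_lt/(_ _ vt0) near_rv := rvt.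
  have /cvg_rnormP := rvt; apply: cvg_trans; apply: near_eq_cvg.
  near=> n => /=; rewrite rnormBC /s /patch mem_set //; split => //=.
  have : `|0 - rnorm (r n t - v t)| < rnorm (v t) by near: n.
  rewrite sub0r normrN ger0_norm ?rnorm_ge0 // => h.
  by apply: (le_trans (rnorm_dist _ (v t))); lra.
- move=> n t Dt; rewrite gee0_abs ?lee_fin ?rnorm_ge0 //.
  by apply: (le_trans (rnormB _ _)); have := sv n t Dt; lra.
Unshelve. all: by end_near. Qed.

End LpLimits.

(** * Admissible operators *)

Section Extrapolation.
Variables (R : realType) (k : scalar_kind).
Variables (X Xm1 : normedModType (scalar_field R k)).
Variables (T : R -> {linear X -> X}) (domA : set X) (A : X -> X) (j : {linear X -> Xm1}).
Hypotheses (C0T : C0_semigroup T) (genA : is_generator T domA A).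

Lemma resolvent_injective (lambda : scalar_field R k) (Q : {linear X -> X}) x :
  is_resolvent domA A lambda Q -> Q x = 0 -> x = 0.
Proof.
move=> [_ Q2 _] Qx; have [_] := Q2 x; have [_] := Q2 0.
by rewrite Qx linear0 scaler0 sub0r => -> ->.
Qed.

(* The difference quotients of T applied to (lambda - A)^-1 x recover
   A (lambda - A)^-1 x, hence x; each of them is controlled by the norm of X_{-1}. *)
Lemma extrapolation_regularization :
  (exists (lambda : scalar_field R k) (Q : {linear X -> X}),
    is_resolvent domA A lambda Q /\ forall x, `|j x| = `|Q x|) ->
  exists W : nat -> {linear X -> X},
    (forall n, exists2 c, 0 <= c & forall x, rnorm (W n x) <= c * rnorm (j x)) /\
    forall x, W n x @[n --> \oo] --> x.
Proof.
move=> [lambda [Q [[cQ Q2 Q3] jQ]]]; case: C0T => cT _ _ _.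
pose h n : R := n.+1%:R^-1.
have h0 n : 0 < h n by rewrite invr_gt0.
pose L n : {linear X -> X} :=
  (lambda \*: Q \- (of_real k (h n))^-1 \*: ((T (h n) \o Q) \- Q)).
exists L; split=> [n|x].
- have [M M0 TM] := continuous_linear_bound (cT _ (ltW (h0 n))).
  exists (re_part `|lambda| + (h n)^-1 * (M + 1)).
    rewrite addr_ge0 ?mulr_ge0 ?addr_ge0 ?invr_ge0 ?(ltW (h0 n)) ?(ltW M0) //.
    by rewrite -(ler_of_real k) of_real0 re_part_ge0.
  move=> x; rewrite /L /=.
  have -> : rnorm (j x) = rnorm (Q x) by rewrite /rnorm jQ.
  rewrite (le_trans (rnormB _ _)) // mulrDl lerD ?rnormZ //.
  rewrite -of_realV normr_of_real of_realK gtr0_norm ?invr_gt0 // -mulrA ler_pM2l ?invr_gt0 //.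
  by rewrite (le_trans (rnormB _ _)) // mulrDl mul1r lerD2r.
- have [dQ QA] := Q2 x.
  have /genA := conj dQ (erefl (A (Q x))) => TQ.
  have hx : h n @[n --> \oo] --> (0 : R)^'+.
    move=> U /= [e e0 eU]; have /cvgrPdist_lt/(_ _ e0) := @cvg_harmonic R.
    by apply: filterS => n /= /eU; apply; exact: h0.
  rewrite -[X in _ --> X](_ : lambda *: Q x - A (Q x) = x) //.
  by apply: cvgB; [exact: cvg_cst|exact: cvg_comp hx TQ].
Qed.

End Extrapolation.

Lemma lebesgue_measure_itv_fin (R : realType) (a b : R) :
  (@lebesgue_measure R `[a, b] < +oo)%E.
Proof. by rewrite lebesgue_measure_itv /=; case: ifP => // _; rewrite -EFinB ltry. Qed.

Section ConvolutionBound.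
Variables (R : realType) (k : scalar_kind).
Variables (Xm1 : completeNormedModType (scalar_field R k)) (V : normedModType (scalar_field R k)).
Variables (Tm1 : R -> {linear Xm1 -> Xm1}) (B : {linear V -> Xm1}) (tau : R).
Hypotheses (C0Tm1 : C0_semigroup Tm1) (cB : continuous B).
Local Notation mu := (@lebesgue_measure R).
Local Notation D := (`[0, tau]%classic : set R).
Local Notation conv v := (fun s => Tm1 (tau - s) (B (v s))).

(** A bound in the norm of X_{-1} only. Followed by a regularising operator, it makes the
    regularised input map continuous for the L^1 distance. *)
Lemma convolution_L1_bound : exists2 c : R, 0 <= c & forall v I,
  strongly_measurable D v -> is_bochner_integral D (conv v) I ->
  ((rnorm I)%:E <= c%:E * \int[mu]_(t in D) (rnorm (v t))%:E)%E.
Proof.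
have [M M1 TM] := C0_semigroup_bound C0Tm1 tau.
have [C C0 BC] := continuous_linear_bound cB.
have M0 : 0 <= M by rewrite (le_trans ler01).
have mD : measurable D by exact: measurable_itv.
have Dfin := lebesgue_measure_itv_fin 0 tau.
exists (M * C); first by rewrite mulr_ge0 // ltW.
move=> v I mv vI; apply: (le_trans (bochner_rnorm_le mD Dfin vI)).
have MC0 : (0 <= (M * C)%:E)%E by rewrite lee_fin mulr_ge0 // ltW.
rewrite -ge0_integralZl //; last 2 first.
- exact: strongly_measurable_Ernorm.
- by move=> t _; rewrite lee_fin rnorm_ge0.
apply: ge0_le_integral => //.
- by move=> t _; rewrite lee_fin rnorm_ge0.
- by apply: strongly_measurable_Ernorm => //; case: vI.
- by apply: measurable_funeM; exact: strongly_measurable_Ernorm.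
- move=> t; rewrite /= in_itv /= => /andP[t0 tt]; rewrite -EFinM lee_fin -mulrA.
  apply: (le_trans (TM _ _ _)); first by rewrite subr_ge0 tt lerBlDr lerDl.
  by rewrite ler_wpM2l // BC.
Qed.

End ConvolutionBound.

Section AdmissibleEstimate.
Variables (R : realType) (k : scalar_kind).
Variables (X : normedModType (scalar_field R k)).
Variables (Xm1 V : completeNormedModType (scalar_field R k)).
Variables (T : R -> {linear X -> X}) (domA : set X) (A : X -> X) (j : {linear X -> Xm1}).
Variables (Tm1 : R -> {linear Xm1 -> Xm1}) (p : R) (B : {linear V -> Xm1}) (tau : R).
Hypotheses (C0T : C0_semigroup T) (genA : is_generator T domA A).
Hypothesis extrap : is_extrapolation_space domA A j.
Hypothesis C0Tm1 : C0_semigroup Tm1.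
Hypotheses (p1 : 1 <= p) (cB : continuous B).
Local Notation mu := (@lebesgue_measure R).
Local Notation D := (`[0, tau]%classic : set R).
Local Notation conv v := (fun s => Tm1 (tau - s) (B (v s))).

Hypothesis adm : forall v : R -> V, in_Lp `[0, +oo[ p v ->
  exists x : X, is_bochner_integral D (conv v) (j x).

Let mD : measurable D. Proof. exact: measurable_itv. Qed.
Let Dfin : (mu D < +oo)%E. Proof. exact: lebesgue_measure_itv_fin. Qed.

Lemma extrapolation_injective x : j x = 0 -> x = 0.
Proof.
case: extrap => _ [lambda [Q [rQ jQ]]] jx; apply: (resolvent_injective rQ).
by apply/normr0_eq0; rewrite -jQ jx normr0.
Qed.

Lemma admissible_exists (v : R -> V) : in_Lp D p v ->
  exists x : X, is_bochner_integral D (conv v) (j x).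
Proof.
move=> [mv fv]; have D0 : D `<=` `[0, +oo[.
  by move=> t /=; rewrite !in_itv /= => /andP[-> _].
have [|x Hx] := adm (v := patch (fun=> 0) D v).
  by split; [exact: strongly_measurable_patch|rewrite Lp_norm_patch].
exists x; apply: (eq_bochner mD Dfin _ Hx) => t tD; by rewrite /patch tD.
Qed.

(* Uniform boundedness: the maps v |-> W n x are bounded on simple functions
   for each n, and converge pointwise to v |-> x; the limit functions produced by a
   gliding hump are limits of simple functions. *)
Lemma admissible_estimate : exists2 K : R, 0 < K & forall (v : R -> V) (x : X),
  in_Lp D p v -> is_bochner_integral D (conv v) (j x) ->
  ((rnorm x)%:E <= K%:E * Lp_norm D p v)%E.
Proof.
have [W [Wb Wx]] := extrapolation_regularization C0T genA extrap.2.
have [c1 c10 cL1] := convolution_L1_bound tau C0Tm1 cB.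
(* [Lam v] is x_v, made total by the value 0 off L^p. *)
have /choice[Lam LamP] : forall v : R -> V, exists x : X,
    in_Lp D p v -> is_bochner_integral D (conv v) (j x).
  move=> v; have [/admissible_exists[x Hx]|nv] := pselect (in_Lp D p v); first by exists x.
  by exists 0.
have LamU v x : in_Lp D p v -> is_bochner_integral D (conv v) (j x) -> Lam v = x.
  move=> Lv vx; apply/eqP; rewrite -subr_eq0; apply/eqP/extrapolation_injective.
  by rewrite linearB (bochner_unique mD Dfin vx (LamP v Lv)) subrr.
(* [W n] brings the bound from the norm of X_{-1} back to X, at the price of a constant depending on
   n. *)
have LamBW n : exists2 c, 0 <= c & forall v w, in_Lp D p v -> in_Lp D p w ->
    ((rnorm (W n (Lam v) - W n (Lam w)))%:E <= c%:E * L1dist D v w)%E.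
  have [c c0 cW] := Wb n; exists (c * c1); first by rewrite mulr_ge0.
  move=> v w Lv Lw; rewrite EFinM -muleA.
  apply: (@le_trans _ _ (c%:E * (rnorm (j (Lam v) - j (Lam w)))%:E)%E).
    by rewrite -EFinM lee_fin -!linearB.
  apply: lee_wpmul2l; first by rewrite lee_fin.
  apply: (cL1 (fun t => v t - w t)); first by apply: strongly_measurableB; [case: Lv|case: Lw].
  apply: (eq_bochner mD Dfin _ (bochnerB mD Dfin (LamP v Lv) (LamP w Lw))) => s _.
  by rewrite !linearB.
have simpleLp (s : R -> V) : vsimple s -> in_Lp D p s.
  by move=> fs; split; [exact: vsimple_strongly_measurable|exact: vsimple_Lp_norm].
have in_LpD v w : in_Lp D p v -> in_Lp D p w -> in_Lp D p (fun t => v t + w t).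
  move=> [mv fv] [mw fw]; split; first exact: strongly_measurableD.
  by apply: (le_lt_trans (Lp_normD p1 mD mv mw)); exact: lte_add_pinfty.
have LamD v w : in_Lp D p v -> in_Lp D p w -> Lam (fun t => v t + w t) = Lam v + Lam w.
  move=> Lv Lw; apply: LamU; first exact: in_LpD.
  rewrite linearD; apply: (eq_bochner mD Dfin _ (bochnerD mD Dfin (LamP v Lv) (LamP w Lw))).
  by move=> s _; rewrite !linearD.
have LamZ (a : scalar_field R k) v : in_Lp D p v -> Lam (fun t => a *: v t) = a *: Lam v.
  move=> Lv; apply: LamU; first exact: in_LpZ.
  have caX : continuous (a \*: idfun : {linear Xm1 -> Xm1}).
    by move=> x; apply: cvgZr; exact: cvg_id.
  have := bochner_op mD Dfin caX (LamP v Lv); rewrite linearZ /= => H.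
  by apply: (eq_bochner mD Dfin _ H) => s _; rewrite /= !linearZ.
pose S : set (R -> V) := [set s | vsimple s].
pose N (s : R -> V) := fine (Lp_norm D p s).
have NE v : in_Lp D p v -> Lp_norm D p v = (N v)%:E.
  by move=> [_ fv]; rewrite /N fineK // ge0_fin_numE // Lp_norm_ge0.
have SS : real_subspace S.
  split=> [s s' fs fs'|r s fs].
    exact: (finite_range_comp (fun w : V * V => w.1 + w.2) (finite_range_pair fs fs')).
  exact: (finite_range_comp (fun w : V => of_real k r *: w) fs).
have sN : seminorm_on S N.
  split=> [s s' fs fs'|r s fs].
    rewrite -lee_fin EFinD -!NE; [|exact: simpleLp|exact: simpleLp|exact: simpleLp (SS.1 _ _ fs fs')].
    by apply: Lp_normD => //; exact: vsimple_strongly_measurable.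
  apply: EFin_inj; rewrite EFinM -!NE; [|exact: simpleLp|exact: simpleLp (SS.2 r _ fs)].
  by apply: Lp_normZ => //; exact: vsimple_strongly_measurable.
have sg n : seminorm_on S (fun s => rnorm (W n (Lam s))).
  split=> [s s' fs fs'|r s fs].
    by rewrite (LamD _ _ (simpleLp _ fs) (simpleLp _ fs')) linearD rnormD.
  by rewrite (LamZ _ _ (simpleLp _ fs)) linearZ rnormZr.
have L0 : in_Lp D p (fun=> 0 : V) by apply: simpleLp; exact: finite_range_cst.
have Lam0 : Lam (fun=> 0) = 0.
  by have := LamZ 0 _ L0; rewrite !scale0r.
have gN n : exists c, forall s, S s -> rnorm (W n (Lam s)) <= c * N s.
  have [c c0 cW] := LamBW n; exists (c * (fine (mu D) + 1)) => s fs.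
  rewrite -lee_fin; have := cW s _ (simpleLp s fs) L0; rewrite Lam0 linear0 subr0.
  move/le_trans; apply; rewrite -mulrA [in leRHS]EFinM; apply: lee_wpmul2l; first by rewrite lee_fin.
  rewrite EFinM -NE; last exact: simpleLp.
  apply: le_trans (L1_le_Lp p1 mD Dfin (vsimple_strongly_measurable D fs)).
  by rewrite /L1dist; under eq_integral do rewrite subr0.
have limW n v (s : nat -> R -> V) : in_Lp D p v -> (forall m, vsimple (s m)) ->
    L1dist D v (s m) @[m --> \oo] --> 0%E ->
    rnorm (W n (Lam (s m))) @[m --> \oo] --> rnorm (W n (Lam v)).
  move=> Lv fs vs; apply: cvg_rnorm; have [c c0 cW] := LamBW n.
  apply: (@cvge0_rnorm _ _ _ _ _ (fun m => c%:E * L1dist D v (s m))%E).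
    by move=> m; rewrite rnormBC; apply: cW => //; exact: simpleLp.
  by rewrite -[X in _ --> X](mule0 c%:E); apply: cvgeZl.
have [||C C0 CH] := gliding_hump SS sN sg gN; first exact: finite_range_cst.
  move=> x i Sx xN big.
  have [|v Lv xv] := Lp_geometric_limit p1 mD Dfin Sx.
    move=> n; have Sd : S (x n.+1 - x n) by exact: real_subspaceB.
    have /= := NE _ (simpleLp _ Sd); have := xN n.
    by rewrite -lee_fin => h e; move: h; rewrite -e.
  (* For a fixed functional the lower bound n passes to the L^1 limit v. This contradicts the
     boundedness of the convergent sequence [W n (Lam v)]. *)
  have gv n : n%:R <= rnorm (W (i n) (Lam v)).
    have := limW (i n) v x Lv Sx xv; move/cvgr_to_ge; apply.
    by exists n => //= m; exact: big.
  have : rnorm (W n (Lam v)) @[n --> \oo] --> rnorm (Lam v) by apply: cvg_rnorm; exact: Wx.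
  move=> /cvgP/cvg_seq_bounded[M [_ /(_ (M + 1))]].
  rewrite ltrDl ltr01 => /(_ isT) MB.
  have := gv (Num.trunc (`|M| + 1)).+1.
  rewrite leNgt => /negP; apply; apply: le_lt_trans (truncnS_gt _).
  apply: le_trans (ler_norm _) _; apply: (le_trans (MB _ Logic.I)).
  by rewrite lerD2r ler_norm.
(* C serves simple functions; the factor 2 is the loss of norm in approximating v by them. *)
exists (C * 2) => [|v x Lv vx]; first by rewrite mulr_gt0.
rewrite -(LamU v x Lv vx) NE // -EFinM lee_fin.
have : rnorm (W n (Lam v)) @[n --> \oo] --> rnorm (Lam v) by apply: cvg_rnorm; exact: Wx.
move/cvgr_to_le; apply; apply: nearW => n.
have [s [fs Ns vs]] := Lp_simple_approx p1 mD Dfin Lv.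
have := limW n v s Lv fs vs; move/cvgr_to_le; apply; apply: nearW => m.
apply: (le_trans (CH n _ (fs m))); rewrite -mulrA ler_pM2l //.
by rewrite -lee_fin EFinM -!NE //; exact: simpleLp.
Qed.

End AdmissibleEstimate.

(** * From one admissible horizon to all intervals [0, t] with t <= te *)

Section AdmissibleOnIntervals.
Variables (R : realType) (k : scalar_kind).
Variables (X Xm1 V : completeNormedModType (scalar_field R k)).
Variables (T : R -> {linear X -> X}) (domA : set X) (A : X -> X) (j : {linear X -> Xm1}).
Variables (Tm1 : R -> {linear Xm1 -> Xm1}) (p : R) (B : {linear V -> Xm1}).
Hypotheses (C0T : C0_semigroup T) (genA : is_generator T domA A).
Hypothesis extrap : is_extrapolation_space domA A j.
Hypothesis extT : is_extrapolated_semigroup j T Tm1.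
Hypotheses (p1 : 1 <= p) (cB : continuous B).
Local Notation mu := (@lebesgue_measure R).
Local Notation "f 1_ D" := (patch (fun=> 0) D f) (at level 10).

(* By translation, the input on ]b - tau, b] is an admissible input on [0, tau]. *)
Lemma admissible_window (tau K M : R) (t b : R) (v : R -> V) :
  (forall w, in_Lp `[0, tau] p w -> exists2 x : X,
     is_bochner_integral `[0, tau] (fun s => Tm1 (tau - s) (B (w s))) (j x) &
     ((rnorm x)%:E <= K%:E * Lp_norm `[0%R, tau] p w)%E) ->
  b <= t -> 0 <= K -> 0 <= M -> (forall x, rnorm (T (t - b) x) <= M * rnorm x) ->
  in_Lp `[0, t] p v ->
  exists2 x : X,
    is_bochner_integral `[0, t]
      (fun s => Tm1 (t - s) (B ((v 1_ (`[0, t] `&` `]b - tau, b])) s))) (j x) &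
    ((rnorm x)%:E <= (M * K)%:E * Lp_norm `[0%R, t] p v)%E.
Proof.
move=> adm bt K0 M0 TM [mv fv]; set J := `[0, t] `&` `]b - tau, b].
have mt : measurable (`[0, t]%classic : set R) by exact: measurable_itv.
have mJ : measurable J by apply: measurableI; exact: measurable_itv.
have Jt : J `<=` `[0, t] by exact: subIsetl.
have mvJ : strongly_measurable J v by exact: strongly_measurableS mv.
(* The window may reach below 0, so the input is set to 0 outside J. *)
pose w := v 1_ J; pose D1 : set R := `[b - tau, b]%classic.
have mw D : strongly_measurable D w by exact: strongly_measurable_patch.
have mD1 : measurable D1 by exact: measurable_itv.
have JD1 : J `<=` D1.
  by move=> s [_ /=]; rewrite /D1 /= !in_itv /= => /andP[/ltW -> ->].
have shift : (fun s => s + (b - tau)) @^-1` D1 = `[0, tau]%classic.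
  apply/seteqP; split=> s; rewrite /D1 /= !in_itv /= => /andP[h1 h2]; apply/andP; split; lra.
have mw' : strongly_measurable `[0, tau] (fun s => w (s + (b - tau))).
  by rewrite -shift; exact: strongly_measurable_translate.
have Nw : (Lp_norm `[0%R, tau] p (fun s => w (s + (b - tau))%R) <= Lp_norm `[0%R, t] p v)%E.
  rewrite -shift Lp_norm_translate // Lp_norm_patch //; exact: Lp_norm_subset.
have [|x wx xw] := adm (fun s => w (s + (b - tau))).
  by split=> //; exact: le_lt_trans Nw fv.
have [C0Tm1 Tj] := extT; have [cTm1 _ Tm1D _] := C0Tm1.
(* x is the contribution of the window at its end b; the semigroup carries it on to time t. *)
exists (T (t - b) x); last first.
  rewrite (@le_trans _ _ (M%:E * (rnorm x)%:E)%E) // -?EFinM ?lee_fin //.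
  rewrite 2!EFinM -muleA; apply: lee_wpmul2l; first by rewrite lee_fin.
  by apply: (le_trans xw); apply: lee_wpmul2l.
have := bochner_translate (tau - b) (measurable_itv _) (lebesgue_measure_itv_fin _ _) wx.
have -> : (fun s => s + (tau - b)) @^-1` `[0, tau] = D1.
  apply/seteqP; split=> s; rewrite /D1 /= !in_itv /= => /andP[h1 h2]; apply/andP; split; lra.
have D1fin : (mu D1 < +oo)%E by exact: lebesgue_measure_itv_fin.
have tb0 : 0 <= t - b by rewrite subr_ge0.
move=> /(bochner_op mD1 D1fin (cTm1 _ tb0)); rewrite Tj //.
set f := (X in is_bochner_integral D1 X _) => fx.
have {}fx : is_bochner_integral D1 (fun s => Tm1 (t - s) (B (w s))) (j (T (t - b) x)).
  apply: (eq_bochner mD1 D1fin _ fx) => s /set_mem; rewrite /D1 /= in_itv /= => /andP[h1 h2].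
  rewrite /f.
  have -> : tau - (s + (tau - b)) = b - s by lra.
  have -> : s + (tau - b) + (b - tau) = s by lra.
  have -> : t - s = (t - b) + (b - s) by lra.
  have bs0 : 0 <= b - s by rewrite subr_ge0.
  by rewrite (Tm1D (t - b) (b - s)).
have := bochner_restrict mJ mD1 D1fin JD1 _ fx.
have w0 s : ~ J s -> Tm1 (t - s) (B (w s)) = 0.
  by move=> nJ; rewrite /w /patch memNset // !linear0.
move=> /(_ (fun s _ => w0 s)).
move=> /(bochner_extend mJ mt (lebesgue_measure_itv_fin _ _) Jt); apply: eq_bochner => //.
  exact: lebesgue_measure_itv_fin.
move=> s _; have [Js|nJs] := pselect (J s); first by rewrite {1}/patch (mem_set Js).
by rewrite {1}/patch (memNset nJs) w0.
Qed.

Lemma admissible_bound (te : R) : Lp_admissible j Tm1 p B ->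
  exists2 K : R, 0 < K & forall t, 0 <= t <= te -> forall v, in_Lp `[0, t] p v ->
    exists2 x : X,
      is_bochner_integral `[0, t] (fun s => Tm1 (t - s) (B (v s))) (j x) &
      ((rnorm x)%:E <= K%:E * Lp_norm `[0%R, t] p v)%E.
Proof.
move=> [tau tau0 adm]; have C0Tm1 := extT.1.
have [K K0 KH] := admissible_estimate C0T genA extrap C0Tm1 p1 cB adm.
have {}adm w : in_Lp `[0, tau] p w -> exists2 x : X,
     is_bochner_integral `[0, tau] (fun s => Tm1 (tau - s) (B (w s))) (j x) &
     ((rnorm x)%:E <= K%:E * Lp_norm `[0%R, tau] p w)%E.
  move=> Lw; have [x wx] := admissible_exists p1 adm Lw.
  by exists x => //; exact: KH.
(* Windows are counted backwards from t. As n tau > te strictly, n half-open windows cover [0, t]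
   including 0, and M must bound the semigroup up to n tau. *)
pose n := (Num.trunc (te / tau)).+1.
have [M M1 TM] := C0_semigroup_bound C0T (n%:R * tau).
have M0 : 0 < M by exact: lt_le_trans M1.
exists (n%:R * (M * K)); first by rewrite !mulr_gt0.
move=> t /andP[t0 tte] v Lv; have [mv fv] := Lv.
have mt : measurable (`[0, t]%classic : set R) by exact: measurable_itv.
have tfin := lebesgue_measure_itv_fin 0 t.
have N0 : (0 <= Lp_norm `[0%R, t] p v)%E by exact: Lp_norm_ge0.
have H m : (m <= n)%N -> exists2 x : X,
    is_bochner_integral `[0, t]
      (fun s => Tm1 (t - s) (B ((v 1_ (`[0, t] `&` `]t - m%:R * tau, t])) s))) (j x) &
    ((rnorm x)%:E <= (m%:R * (M * K))%:E * Lp_norm `[0%R, t] p v)%E.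
  elim: m => [_|m IH mn].
    exists 0; last by rewrite rnorm0 mul0r mul0e.
    rewrite linear0; apply: (eq_bochner mt tfin _ (bochner0 mt tfin Xm1)) => s _.
    rewrite /patch memNset ?linear0 // => -[_ /=].
    by rewrite mul0r subr0 in_itv /= => /andP[/lt_le_trans h /h]; rewrite ltxx.
  have [x vx xv] := IH (ltnW mn).
  have b_le : t - m%:R * tau <= t by rewrite gerBl mulr_ge0 // ltW.
  have [|y vy yv] := @admissible_window tau K M t (t - m%:R * tau) v adm b_le (ltW K0) (ltW M0) _ Lv.
    move=> y; apply: TM; rewrite subKr mulr_ge0 ?(ltW tau0) //= ler_pM2r // ler_nat; exact: ltnW.
  exists (x + y).
    rewrite linearD; apply: (eq_bochner mt tfin _ (bochnerD mt tfin vx vy)) => s st.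
    (* Half-open windows are disjoint, so the two cut inputs add up to the input on their union. *)
    rewrite -!linearD; congr (Tm1 _ (B _)); rewrite /patch !in_setI st /=.
    rewrite !mem_setE !in_itv /= -natr1 mulrDl mul1r opprD addrA.
    move/set_mem : st; rewrite /= in_itv /= => /andP[_ ->]; rewrite !andbT.
    have [h1|h1] := ltP (t - m%:R * tau) s; rewrite ?andbF ?andbT.
      by rewrite addr0 (lt_trans _ h1) // ltrBlDr ltrDl.
    by rewrite add0r.
  apply: (@le_trans _ _ (rnorm x + rnorm y)%:E); first by rewrite lee_fin rnormD.
  rewrite EFinD -natr1 mulrDl mul1r EFinD ge0_muleDl ?lee_fin ?mulr_ge0 ?(ltW M0) ?(ltW K0) //.
  exact: leeD.
have [x vx xv] := H n (leqnn n); exists x => //.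
apply: (eq_bochner mt tfin _ vx) => s st; congr (Tm1 _ (B _)).
rewrite /patch mem_set //; split; first exact: set_mem.
move/set_mem : st; rewrite /= !in_itv /= => /andP[s0 ->]; rewrite andbT ltrBlDr.
rewrite (le_lt_trans tte) // -[X in X < _]add0r ler_ltD //.
by rewrite -ltr_pdivrMr // truncnS_gt.
Qed.

End AdmissibleOnIntervals.

(** * Dependence of mild solutions on the data *)

Section ContinuousFunctions.
Variables (R : realType) (k : scalar_kind).
Variable V : normedModType (scalar_field R k).

Lemma finite_range_nat (f : R -> nat) (N : nat) : (forall t, (f t <= N)%N) ->
  (forall m, measurable [set t | (m < f t)%N]) -> finite_range f.
Proof.
move=> fN mf; split.
  by apply: (@sub_finite_set _ _ `I_N.+1) => // _ [t _ <-] /=; rewrite ltnS.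
case=> [|m].
  have -> : f @^-1` [set 0%N] = ~` [set t | (0 < f t)%N].
    by apply/seteqP; split=> t /=; [move=> -> //|move/negP; rewrite lt0n negbK => /eqP].
  exact: measurableC.
have -> : f @^-1` [set m.+1] = [set t | (m < f t)%N] `\` [set t | (m.+1 < f t)%N].
  apply/seteqP; split=> t /= => [->|[mt /negP]]; first by rewrite ltnSn ltnn.
  by rewrite -leqNgt => tm; apply/eqP; rewrite eqn_leq tm mt.
exact: measurableD.
Qed.

(** The cap makes the range finite on the whole line; it is inactive for t in [0, te]. *)
Lemma finite_range_floor (te : R) (n : nat) :
  finite_range (fun t : R => minn (Num.trunc (t * n.+1%:R)) (Num.trunc (te * n.+1%:R))).
Proof.
apply: (@finite_range_nat _ (Num.trunc (te * n.+1%:R))) => [t|m]; first exact: geq_minr.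
under eq_set do rewrite leq_min.
have [h|h] := boolP (m < Num.trunc (te * n.+1%:R))%N; last first.
  by under eq_set do rewrite andbF; rewrite set_false.
have -> : [set x : R | (m < Num.trunc (x * n.+1%:R))%N && true] = `[m.+1%:R / n.+1%:R, +oo[%classic.
  by apply/seteqP; split=> x /=; rewrite in_itv /= !andbT truncn_gt_nat ler_pdivrMr.
exact: measurable_itv.
Qed.

(** x is sampled at the grid point of mesh 1 / (n + 1) just to the left of t. That point stays in
    [0, te], where continuity of x is available. *)
Lemma within_continuous_strongly_measurable (te : R) (x : R -> V) :
  {within `[0, te], continuous x} -> strongly_measurable `[0, te] x.
Proof.
move=> /subspace_continuousP cx.
pose q n (t : R) : R :=
  (minn (Num.trunc (t * n.+1%:R)) (Num.trunc (te * n.+1%:R)))%:R / n.+1%:R.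
exists (fun n t => x (q n t)); split=> [n|t /= tte].
  exact: (finite_range_comp (fun m => x (m%:R / n.+1%:R)) (finite_range_floor te n)).
move: (tte); rewrite in_itv /= => /andP[t0 tle].
have qE n : q n t = (Num.trunc (t * n.+1%:R))%:R / n.+1%:R.
  by rewrite /q (minn_idPl _) // le_truncn // ler_wpM2r.
have qt n : q n t <= t by rewrite qE ler_pdivrMr // truncn_le // mulr_ge0.
have tq n : t - q n t <= n.+1%:R^-1.
  rewrite qE lerBlDr -[X in _ <= X + _]mul1r -mulrDl ler_pdivlMr //.
  by rewrite addrC natr1 ltW // truncnS_gt.
have q0 n : 0 <= q n t by rewrite qE divr_ge0.
have qq : q n t @[n --> \oo] --> within `[0, te] (nbhs t).
  move=> U /= [e e0 eU]; have /cvgrPdist_lt/(_ _ e0) := @cvg_harmonic R.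
  apply: filterS => n /=; rewrite sub0r normrN ger0_norm ?invr_ge0 // => ne.
  have := eU (q n t); apply; last by rewrite /= in_itv /= q0 (le_trans (qt n)).
  by rewrite /ball /= ger0_norm ?subr_ge0 // (le_lt_trans (tq n)).
exact: cvg_comp qq (cx t tte).
Qed.

Lemma within_continuous_bounded (te : R) (x : R -> V) : 0 <= te ->
  {within `[0, te], continuous x} ->
  exists2 b, 0 <= b & forall t, 0 <= t <= te -> rnorm (x t) <= b.
Proof.
move=> te0 /subspace_continuousP cx.
have [|c _ cH] := @EVT_max R (fun t => rnorm (x t)) 0 te te0.
  by apply/subspace_continuousP => t tte; apply: cvg_rnorm; exact: cx.
by exists (rnorm (x c)) => [|t tte]; [exact: rnorm_ge0|apply: cH; rewrite in_itv].
Qed.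

End ContinuousFunctions.

Lemma bounded_bilinear_cvg (R : realType) (k : scalar_kind)
    (U V W : normedModType (scalar_field R k)) (F : {bilinear U -> V -> W}) :
  bounded_bilinear F -> forall (u : U^nat) (v : V^nat) a b,
    u n @[n --> \oo] --> a -> v n @[n --> \oo] --> b -> F (u n) (v n) @[n --> \oo] --> F a b.
Proof.
move=> [C C0 FC] u v a b ua vb.
apply: (@squeeze_rnorm _ _ _ _ _ _ _ _
  (fun n => C * rnorm (u n - a) * rnorm (v n) + C * rnorm a * rnorm (v n - b))).
  apply: nearW => n.
  have -> : F (u n) (v n) - F a b = F (u n - a) (v n) + F a (v n - b).
    by rewrite linearBl linearBr addrA subrK.
  by apply: (le_trans (rnormD _ _)); rewrite lerD.
have ua0 : rnorm (u n - a) @[n --> \oo] --> (0 : R) by exact/cvg_rnormP.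
have vb0 : rnorm (v n - b) @[n --> \oo] --> (0 : R) by exact/cvg_rnormP.
have vn : rnorm (v n) @[n --> \oo] --> rnorm b by exact: cvg_rnorm.
rewrite [X in _ --> X](_ : 0 = C * 0 * rnorm b + C * rnorm a * 0); last first.
  by rewrite !mulr0 mul0r addr0.
by apply: cvgD; [apply: cvgM => //|]; apply: cvgMr.
Qed.

(** Absorption: the supremum s of f is finite by the a priori bound [b0] and satisfies s <= e + s /
    2. The value of [b0] is lost in the conclusion, so it may depend on the solution being
    estimated. *)
Lemma halving_bound (R : realType) (I : Type) (S : set I) (f : I -> R) (b0 e : R) :
  (forall i, S i -> 0 <= f i <= b0) ->
  (forall b, (forall i, S i -> f i <= b) -> forall i, S i -> f i <= e + b / 2) ->
  forall i, S i -> f i <= 2 * e.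
Proof.
move=> fb0 half i Si; set s := sup (f @` S).
have hs : has_sup (f @` S).
  by split; [exists (f i), i|exists b0 => _ [i' /fb0/andP[_ h] <-]].
have fs i' : S i' -> f i' <= s by move=> Si'; apply: sup_upper_bound => //; exists i'.
have : s <= e + s / 2.
  by apply: ge_sup => [|_ [i' Si' <-]]; [exists (f i), i|exact: half].
by have := fs i Si; lra.
Qed.

(** * The difference of two mild solutions and the absorption argument *)

Section MildSolutionDifference.
Variables (R : realType) (k : scalar_kind).
Variables (X U1 U2 Z : completeNormedModType (scalar_field R k)).
Variables (T : R -> {linear X -> X}) (domA : set X) (A : X -> X).
Variables (Xm1 : completeNormedModType (scalar_field R k)) (j : {linear X -> Xm1}).
Variables (Tm1 : R -> {linear Xm1 -> Xm1}) (p1 p2 : R).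
Variables (B1 : {linear Z -> Xm1}) (B2 : {linear U2 -> Xm1}).
Variables (F : {bilinear U1 -> X -> Z}) (te : R).
Hypotheses (C0T : C0_semigroup T) (genA : is_generator T domA A).
Hypothesis extrap : is_extrapolation_space domA A j.
Hypothesis extT : is_extrapolated_semigroup j T Tm1.
Hypotheses (p1_ge1 : 1 <= p1) (p2_ge1 : 1 <= p2).
Hypotheses (cB1 : continuous B1) (adm1 : Lp_admissible j Tm1 p1 B1).
Hypotheses (cB2 : continuous B2) (adm2 : Lp_admissible j Tm1 p2 B2).
Local Notation mild := (is_mild_solution j T Tm1 B1 B2 F te).
Local Notation mu := (@lebesgue_measure R).

(** The two integrals in X_{-1} differ by j z1 + j z2, where z1 and z2 are the admissible responses
    to f and to u2' - u2. Injectivity of j turns this into an identity in X, where the uniform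
    bounds on [0, te] apply. The constants are chosen before the data and the time. *)
Lemma mild_solution_difference : exists M K1 K2 : R, [/\ 0 < M, 0 < K1, 0 < K2 &
  forall x0 u1 u2 x x0' u1' u2' x' (f : R -> Z) t (Nf Nd : R),
    mild x0 u1 u2 x -> mild x0' u1' u2' x' -> 0 <= t <= te ->
    (forall s, f s = F (u1' s) (x' s) - F (u1 s) (x s)) ->
    strongly_measurable `[0, t] f -> (Lp_norm `[0%R, t] p1 f <= Nf%:E)%E ->
    strongly_measurable `[0, t] (fun s => u2' s - u2 s) ->
    (Lp_norm `[0%R, t] p2 (fun s => (u2' s - u2 s)%R) <= Nd%:E)%E ->
    rnorm (x' t - x t) <= M * rnorm (x0' - x0) + K1 * Nf + K2 * Nd].
Proof.
have [M M1 TM] := C0_semigroup_bound C0T te.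
have [K1 K10 est1] := admissible_bound C0T genA extrap extT p1_ge1 cB1 te adm1.
have [K2 K20 est2] := admissible_bound C0T genA extrap extT p2_ge1 cB2 te adm2.
exists M, K1, K2; split=> //; first exact: lt_le_trans M1.
move=> x0 u1 u2 x x0' u1' u2' x' f t Nf Nd [_ Sx] [_ Sx'] tte fE mf Lf md Ld.
have mt : measurable (`[0, t]%classic : set R) by exact: measurable_itv.
have tfin := lebesgue_measure_itv_fin 0 t.
have [I xI jx] := Sx t tte; have [I' xI' jx'] := Sx' t tte.
have [z1 fz1 Nz1] : exists2 z : X,
    is_bochner_integral `[0, t] (fun s => Tm1 (t - s) (B1 (f s))) (j z) & rnorm z <= K1 * Nf.
  have [|z fz zK] := est1 t tte f; first by split=> //; exact: le_lt_trans Lf (ltry _).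
  exists z => //; rewrite -lee_fin (le_trans zK) // EFinM; apply: lee_wpmul2l => //.
  by rewrite lee_fin ltW.
have [z2 dz2 Nz2] : exists2 z : X,
    is_bochner_integral `[0, t] (fun s => Tm1 (t - s) (B2 (u2' s - u2 s))) (j z) &
    rnorm z <= K2 * Nd.
  have [|z fz zK] := est2 t tte (fun s => u2' s - u2 s).
    by split=> //; exact: le_lt_trans Ld (ltry _).
  exists z => //; rewrite -lee_fin (le_trans zK) // EFinM; apply: lee_wpmul2l => //.
  by rewrite lee_fin ltW.
have II : I' - I = j z1 + j z2.
  apply: (bochner_unique mt tfin (bochnerB mt tfin xI' xI)).
  apply: (eq_bochner mt tfin _ (bochnerD mt tfin fz1 dz2)) => s _.
  rewrite -!linearD -linearB; congr (Tm1 _ _).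
  by rewrite fE (raddfB B1) (raddfB B2) opprD addrACA.
have xE : x' t - x t = T t (x0' - x0) + z1 + z2.
  apply/eqP; rewrite -subr_eq0; apply/eqP/(extrapolation_injective extrap).
  rewrite !(linearB, linearD) /= jx jx'.
  by rewrite opprD [X in X + _]addrACA II -!opprD addrA subrr.
rewrite xE (le_trans (rnormD _ _)) // lerD // (le_trans (rnormD _ _)) // lerD //.
exact: TM.
Qed.

Variables (C : R).
Hypotheses (C0 : 0 < C) (FC : forall u x, rnorm (F u x) <= C * rnorm u * rnorm x).

Lemma bilinear_strongly_measurable (t : R) (u : R -> U1) (x : R -> X) :
  strongly_measurable `[0, t] u -> strongly_measurable `[0, t] x ->
  strongly_measurable `[0, t] (fun s => F (u s) (x s)).
Proof.
by apply: strongly_measurable_comp2; apply: bounded_bilinear_cvg; exists C.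
Qed.

(* F(u1', x') - F(u1, x) = F(d, x') + F(u1, y) with d = u1' - u1, y = x' - x,
   and F(u1, y) is split at time a. *)
Lemma nonlinearity_difference (t a b b0 bx N1 eta delta : R) (u1 u1' : R -> U1) (x x' : R -> X) :
  strongly_measurable `[0, t] u1 -> strongly_measurable `[0, t] u1' ->
  strongly_measurable `[0, t] x -> strongly_measurable `[0, t] x' ->
  (forall s, 0 <= s <= t -> rnorm (x s) <= bx) ->
  (forall s, 0 <= s <= t -> rnorm (x' s - x s) <= b) ->
  (forall s, 0 <= s <= t -> s < a -> rnorm (x' s - x s) <= b0) ->
  0 <= b -> 0 <= b0 -> 0 <= bx ->
  (Lp_norm `[0%R, t] p1 u1 <= N1%:E)%E ->
  (Lp_norm (`[0%R, t] `&` `[a, +oo[) p1 u1 <= eta%:E)%E ->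
  (Lp_norm `[0%R, t] p1 (fun s => (u1' s - u1 s)%R) <= delta%:E)%E ->
  (Lp_norm `[0%R, t] p1 (fun s => (F (u1' s) (x' s) - F (u1 s) (x s))%R) <=
    (C * (bx + b) * delta + C * b0 * N1 + C * b * eta)%:E)%E.
Proof.
move=> mu1 mu1' mx mx' xb yb yb0 b_ge0 b0_ge0 bx_ge0 LN1 Leta Ld.
pose y s := x' s - x s; pose d s := u1' s - u1 s.
have mt : measurable (`[0, t]%classic : set R) by exact: measurable_itv.
pose J : set R := `[0, t] `&` `[a, +oo[.
have mJ : measurable J by apply: measurableI => //; exact: measurable_itv.
have Jt : J `<=` `[0, t] by exact: subIsetl.
have my : strongly_measurable `[0, t] y by exact: strongly_measurableB.
have md : strongly_measurable `[0, t] d by exact: strongly_measurableB.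
have mdx := bilinear_strongly_measurable md mx'.
have muy := bilinear_strongly_measurable mu1 my.
have muyJ : strongly_measurable J (fun s => F (u1 s) (y s)) by exact: strongly_measurableS muy.
have mg3 : strongly_measurable `[0, t] (patch (fun=> 0) J (fun s => F (u1 s) (y s))).
  exact: strongly_measurable_patch.
have mg2 := strongly_measurableB muy mg3.
have fE : {in `[0, t]%classic, forall s, rnorm (F (u1' s) (x' s) - F (u1 s) (x s)) =
    rnorm (F (d s) (x' s) + ((F (u1 s) (y s) - patch (fun=> 0) J (fun s => F (u1 s) (y s)) s) +
      patch (fun=> 0) J (fun s => F (u1 s) (y s)) s))}.
  by move=> s _; rewrite subrK linearBl linearBr addrA subrK.
rewrite (eq_Lp_norm p1_ge1 fE).
apply: (le_trans (Lp_normD p1_ge1 mt mdx (strongly_measurableD mg2 mg3))).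
rewrite -addrA EFinD; apply: leeD.
  apply: (@le_trans _ _ ((C * (bx + b))%:E * Lp_norm `[0%R, t] p1 d)%E).
    apply: Lp_norm_le => //; first by rewrite mulr_ge0 ?addr_ge0 // ltW.
    move=> s; rewrite /= in_itv /= => st; apply: (le_trans (FC _ _)).
    rewrite mulrAC ler_wpM2r ?rnorm_ge0 // ler_pM2l //.
    by apply: (le_trans (rnorm_dist _ (x s))); rewrite lerD ?xb ?yb.
  rewrite [leRHS]EFinM; apply: lee_wpmul2l => //.
  by rewrite lee_fin mulr_ge0 ?addr_ge0 // ltW.
apply: (le_trans (Lp_normD p1_ge1 mt mg2 mg3)); rewrite EFinD; apply: leeD.
  apply: (@le_trans _ _ ((C * b0)%:E * Lp_norm `[0%R, t] p1 u1)%E).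
    apply: Lp_norm_le => //; first by rewrite mulr_ge0 // ltW.
    move=> s; rewrite /= in_itv /= => st; rewrite /patch.
    have [sJ|sJ] := boolP (s \in J).
      by rewrite subrr rnorm0 !mulr_ge0 ?rnorm_ge0 // ltW.
    rewrite subr0; apply: (le_trans (FC _ _)).
    rewrite mulrAC ler_wpM2r ?rnorm_ge0 // ler_pM2l // yb0 //.
    rewrite ltNge; apply/negP => h; move/negP: sJ; apply.
    by apply/mem_set; split; rewrite /= in_itv //= h.
  by rewrite [leRHS]EFinM; apply: lee_wpmul2l => //; rewrite lee_fin mulr_ge0 // ltW.
rewrite Lp_norm_patch //.
apply: (@le_trans _ _ ((C * b)%:E * Lp_norm J p1 u1)%E).
  apply: Lp_norm_le => //.
  - exact: strongly_measurableS mu1.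
  - by rewrite mulr_ge0 // ltW.
  - move=> s [+ _]; rewrite /= in_itv /= => st; apply: (le_trans (FC _ _)).
    by rewrite mulrAC ler_wpM2r ?rnorm_ge0 // ler_pM2l // yb.
by rewrite [leRHS]EFinM; apply: lee_wpmul2l => //; rewrite lee_fin mulr_ge0 // ltW.
Qed.

Hypothesis te0 : 0 < te.

(* Gronwall-type induction over time windows of length h on which u1 is so small
   that the terms containing y can be absorbed. *)
Lemma mild_solution_lipschitz (x0 : X) (u1 : R -> U1) (u2 : R -> U2) (x : R -> X) :
  in_Lp `[0, te] p1 u1 -> in_Lp `[0, te] p2 u2 -> mild x0 u1 u2 x ->
  exists c delta0 : R, [/\ 0 <= c, 0 < delta0 &
    forall delta x0' u1' u2' x', 0 < delta <= delta0 ->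
      in_Lp `[0, te] p1 u1' -> in_Lp `[0, te] p2 u2' -> mild x0' u1' u2' x' ->
      rnorm (x0' - x0) <= delta ->
      (Lp_norm `[0%R, te] p1 (fun t => (u1' t - u1 t)%R) <= delta%:E)%E ->
      (Lp_norm `[0%R, te] p2 (fun t => (u2' t - u2 t)%R) <= delta%:E)%E ->
      forall t, 0 <= t <= te -> rnorm (x' t - x t) <= c * delta].
Proof.
move=> Lu1 Lu2 xm; have [M [K1 [K2 [M0 K10 K20 diff]]]] := mild_solution_difference.
have [bx bx0 xb] := within_continuous_bounded (ltW te0) xm.1.
pose N1 := fine (Lp_norm `[0%R, te] p1 u1).
have N1E : Lp_norm `[0%R, te] p1 u1 = N1%:E.
  by rewrite /N1 fineK // ge0_fin_numE ?Lp_norm_ge0 //; exact: Lu1.2.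
have N10 : 0 <= N1 by exact: fine_ge0 (Lp_norm_ge0 _ _ _).
(* With delta and the window norm of u1 both at most 1 / kappa, the terms K1 C delta b and K1 C b /
   kappa are each at most b / 4, together b / 2. *)
pose kappa := 4 * (K1 * C).
have kappa0 : 0 < kappa by rewrite !mulr_gt0.
have kappaV0 : 0 < kappa^-1 by rewrite invr_gt0.
have mte : measurable (`[0, te]%classic : set R) by exact: measurable_itv.
have [d d0 ac] := Lp_norm_absolute_continuity p1_ge1 mte Lu1 kappaV0.
(* Absolute continuity asks for a measure strictly below d, and the window is enclosed in an
   interval of length exactly h. *)
pose h := d / 2; have h0 : 0 < h by rewrite divr_gt0.
(* [a0] gathers the effect of the changes in x0, u1 and u2; [b1] that of y on the earlier
   windows. *)
pose a0 := M + K1 * C * bx + K2; pose b1 := K1 * C * N1.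
have a00 : 0 <= a0 by rewrite !addr_ge0 ?mulr_ge0 ?(ltW M0) ?(ltW K10) ?(ltW C0) ?(ltW K20).
have b10 : 0 <= b1 by rewrite !mulr_ge0 ?(ltW K10) ?(ltW C0).
(* The factor 2 is the price of absorbing half of the supremum. The recursion starts at 0 because
   there is no time t with 0 <= t < 0. *)
pose c := fix c n := if n is n'.+1 then 2 * (a0 + b1 * c n') else 0.
have c0 n : 0 <= c n.
  by elim: n => //= n IH; apply: mulr_ge0 => //; apply: addr_ge0 => //; exact: mulr_ge0.
pose n := (Num.trunc (te / h)).+1.
exists (c n), kappa^-1; split=> // delta x0' u1' u2' x' /andP[delta0 deltak] Lu1' Lu2' xm'
  Hx0 Hu1 Hu2.
have mx := within_continuous_strongly_measurable xm.1.
have mx' := within_continuous_strongly_measurable xm'.1.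
have [bx' bx'0 xb'] := within_continuous_bounded (ltW te0) xm'.1.
suff H m : forall t, 0 <= t <= te /\ t < m%:R * h -> rnorm (x' t - x t) <= c m * delta.
  move=> t /andP[t0 tte]; apply: H; split; first by rewrite t0.
  by rewrite (le_lt_trans tte) // -ltr_pdivrMr // truncnS_gt.
elim: m => [t [/andP[t0 _]]|m IH]; first by rewrite mul0r ltNge t0.
rewrite /= -mulrA.
(* The supremum runs over all times covered by the first m + 1 windows. Its a priori bound bx' + bx
   depends on x'. *)
apply: (@halving_bound _ _ [set t | 0 <= t <= te /\ t < m.+1%:R * h]
  (fun t => rnorm (x' t - x t)) (bx' + bx)).
  move=> t [tte _]; rewrite rnorm_ge0 /=; apply: (le_trans (rnormB _ _)).
  by rewrite lerD ?xb ?xb'.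
move=> b Hb t [tte th]; have /andP[t0 tle] := tte.
have b0 : 0 <= b by exact: le_trans (rnorm_ge0 _) (Hb t (conj tte th)).
have tsub : `[0, t] `<=` `[0, te].
  by move=> s /=; rewrite !in_itv /= => /andP[-> /le_trans]; apply.
have mt : measurable (`[0, t]%classic : set R) by exact: measurable_itv.
have sub (W : normedModType (scalar_field R k)) (v : R -> W) :
  strongly_measurable `[0, te] v -> strongly_measurable `[0, t] v := strongly_measurableS tsub.
(* The part of [0, t] beyond the induction hypothesis, on which u1 is small. *)
pose J : set R := `[0, t] `&` `[m%:R * h, +oo[.
have mJ : measurable J by apply: measurableI; exact: measurable_itv.
have etaJ : (Lp_norm J p1 u1 <= (kappa^-1)%:E)%E.
  apply: ac => //; first by move=> s [/tsub].
  apply: (@le_lt_trans _ _ (mu `[(m%:R * h)%R, (m%:R * h + h)%R])).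
    apply: le_measure; [exact: mem_set|by apply: mem_set; exact: measurable_itv|].
    move=> s []; rewrite /= !in_itv /= => /andP[_ st] /andP[-> _] /=.
    by move: th; rewrite -natr1 mulrDl mul1r => /ltW; exact: le_trans.
  rewrite lebesgue_measure_itv /= lte_fin ltrDl h0 -EFinD lte_fin addrAC subrr add0r.
  by rewrite /h ltr_pdivrMr // mulr_natr mulr2n ltrDl.
have st_te s : 0 <= s <= t -> 0 <= s <= te by move=> /andP[-> /le_trans]; apply.
have Lsub (W : normedModType (scalar_field R k)) (v : R -> W) q B : 1 <= q ->
    strongly_measurable `[0, te] v ->
    (Lp_norm `[0%R, te] q v <= B -> Lp_norm `[0%R, t] q v <= B)%E.
  by move=> q1 mv; apply: le_trans; exact: Lp_norm_subset.
have md1 := strongly_measurableB Lu1'.1 Lu1.1.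
have md2 := strongly_measurableB Lu2'.1 Lu2.1.
have Lf : (Lp_norm `[0%R, t] p1 (fun s => (F (u1' s) (x' s) - F (u1 s) (x s))%R) <=
    (C * (bx + b) * delta + C * (c m * delta) * N1 + C * b * kappa^-1)%:E)%E.
  apply: (@nonlinearity_difference t (m%:R * h)) => //; try exact: sub.
  - exact: sub Lu1.1.
  - exact: sub Lu1'.1.
  - by move=> s st; apply: xb; exact: st_te.
  - move=> s st; apply: Hb; split; first exact: st_te.
    by case/andP: st => _ /le_lt_trans; apply.
  - by move=> s st sm; apply: IH; split=> //; exact: st_te.
  - by rewrite mulr_ge0 // ltW.
  - by apply: Lsub; [|exact: Lu1.1|rewrite N1E].
  - exact: Lsub.
have := diff _ _ _ _ _ _ _ _ (fun s => F (u1' s) (x' s) - F (u1 s) (x s)) t _ delta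
  xm xm' tte (fun=> erefl) _ Lf (sub _ _ md2) (Lsub _ _ _ _ p2_ge1 md2 Hu2).
have mf : strongly_measurable `[0, t] (fun s => F (u1' s) (x' s) - F (u1 s) (x s)).
  by apply: strongly_measurableB; apply: bilinear_strongly_measurable; apply: sub => //;
    [exact: Lu1'.1|exact: Lu1.1].
move=> /(_ mf) /le_trans; apply.
have h1 : M * rnorm (x0' - x0) <= M * delta by rewrite ler_pM2l.
have h2 : K1 * C * delta <= 4^-1.
  rewrite -(ler_pM2l (_ : 0 < 4 :> R)) // mulfV // mulrA.
  by rewrite -ler_pdivlMl // mulr1.
have h3 : K1 * C * kappa^-1 = 4^-1.
  by rewrite /kappa invfM mulrCA divff ?mulr1 // gt_eqF // mulr_gt0.
have h4 : K1 * C * delta * b <= 4^-1 * b by rewrite ler_wpM2r.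
have -> : K1 * (C * (bx + b) * delta + C * (c m * delta) * N1 + C * b * kappa^-1) =
    K1 * C * bx * delta + K1 * C * delta * b + b1 * c m * delta + K1 * C * kappa^-1 * b.
  by rewrite /b1; ring.
rewrite h3 [leRHS](_ : _ = M * delta + K1 * C * bx * delta + K2 * delta +
  b1 * c m * delta + b / 2); last by rewrite /a0; field.
lra.
Qed.

End MildSolutionDifference.

Theorem proposition1 (R : realType) (k : scalar_kind)
    (X U1 U2 Z : completeNormedModType (scalar_field R k))
    (T : R -> {linear X -> X}) (domA : set X) (A : X -> X)
    (Xm1 : completeNormedModType (scalar_field R k)) (j : {linear X -> Xm1})
    (Tm1 : R -> {linear Xm1 -> Xm1})
    (p1 p2 : R)
    (B1 : {linear Z -> Xm1}) (B2 : {linear U2 -> Xm1})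
    (F : {bilinear U1 -> X -> Z}) (te : R) :
  C0_semigroup T ->
  is_generator T domA A ->
  is_extrapolation_space domA A j ->
  is_extrapolated_semigroup j T Tm1 ->
  1 <= p1 -> 1 <= p2 ->
  continuous B1 -> Lp_admissible j Tm1 p1 B1 ->
  continuous B2 -> Lp_admissible j Tm1 p2 B2 ->
  bounded_bilinear F ->
  0 < te ->
  forall (x0 : X) (u1 : R -> U1) (u2 : R -> U2) (x : R -> X),
    in_Lp `[0, te] p1 u1 -> in_Lp `[0, te] p2 u2 ->
    is_mild_solution j T Tm1 B1 B2 F te x0 u1 u2 x ->
  forall eps : R, 0 < eps -> exists2 delta : R, 0 < delta &
    forall (x0' : X) (u1' : R -> U1) (u2' : R -> U2) (x' : R -> X),
      in_Lp `[0, te] p1 u1' -> in_Lp `[0, te] p2 u2' ->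
      is_mild_solution j T Tm1 B1 B2 F te x0' u1' u2' x' ->
      rnorm (x0' - x0) < delta ->
      (Lp_norm `[0%R, te] p1 (fun t => u1' t - u1 t)%R < delta%:E)%E ->
      (Lp_norm `[0%R, te] p2 (fun t => u2' t - u2 t)%R < delta%:E)%E ->
      (sup_norm `[0%R, te] (fun t => x' t - x t)%R < eps%:E)%E.
Proof.
move=> C0T genA extrap extT p1_ge1 p2_ge1 cB1 adm1 cB2 adm2 [C C0 FC] te0.
move=> x0 u1 u2 x Lu1 Lu2 xm eps eps0.
have [c [d [c0 d0 lip]]] := mild_solution_lipschitz C0T genA extrap extT p1_ge1 p2_ge1
  cB1 adm1 cB2 adm2 C0 FC te0 Lu1 Lu2 xm.
have c1 : 0 < c + 1 by rewrite ltr_wpDl.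
(* c may be 0, hence the division by c + 1. Aiming at eps / 2 keeps the inequality strict after
   taking the supremum. *)
pose delta := Num.min d (eps / 2 / (c + 1)).
have delta0 : 0 < delta by rewrite lt_min d0 !divr_gt0.
exists delta => // x0' u1' u2' x' Lu1' Lu2' xm' /ltW Hx0 /ltW Hu1 /ltW Hu2.
apply: (@le_lt_trans _ _ (eps / 2)%:E); last by rewrite lte_fin; lra.
apply: ub_ereal_sup => _ [t /= tte <-]; rewrite in_itv /= in tte; rewrite lee_fin.
apply: (le_trans (lip delta x0' u1' u2' x' _ Lu1' Lu2' xm' Hx0 Hu1 Hu2 t tte)).
  by rewrite delta0 ge_min lexx.
have : delta <= eps / 2 / (c + 1) by rewrite ge_min lexx orbT.
rewrite ler_pdivlMr // => h; apply: le_trans h.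
by rewrite mulrC ler_pM2l // lerDl.
Qed.
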